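(* Let $G=\mathrm{SU}(2,1)$. Then the map $$\Phi: NA\times\mathcal{D}\to \mathrm{Cr}(X),\qquad (na,(Y,Z))\mapsto na\exp(iY)\exp(iZ)\cdot x_0$$ is a diffeomorphism.
   Context: Let $G=\mathrm{SU}(2,1)\subset G_\mathbb{C}=\mathrm{Sl}(3,\mathbb{C})$, where the Hermitian form has signature $(+,+,-)$ in the standard coordinates of $\mathbb{C}^3$, let $K=S(U(2)\times U(1))$, and let $K_\mathbb{C}=S(\mathrm{Gl}(2,\mathbb{C})\times \mathrm{Gl}(1,\mathbb{C}))$ be its complexification. Let $X=G/K\subset X_\mathbb{C}=G_\mathbb{C}/K_\mathbb{C}$ with base point $x_0=K_\mathbb{C}$. For $t\in\mathbb{R}$ put $$a_t=\begin{pmatrix}\cosh t&0&\sinh t\\0&1&0\\ \sinh t&0&\cosh t\end{pmatrix},\qquad Y_t=\log a_t=\begin{pmatrix}0&0&t\\0&0&0\\t&0&0\end{pmatrix},$$ $A=\{a_t: t\in\mathbb{R}\}$ and $\mathfrak{a}=\mathrm{Lie}(A)$. For $a\in\mathbb{C}$, $b\in\mathbb{R}$ put $$Z_{a,b}=\begin{pmatrix} ib&a&-ib\\-\overline a&0&\overline a\\ ib&a&-ib\end{pmatrix},$$ and let $\mathfrak{n}=\{Z_{a,b}: a\in\mathbb{C},b\in\mathbb{R}\}$, $N=\exp\mathfrak{n}$, so that $G=NAK$ is an Iwasawa decomposition. Let $\Omega=\{Y_t: |t|<\pi/4\}$. The crown domain is $\mathrm{Cr}(X)=G\exp(i\Omega)\cdot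 x_0\subset X_\mathbb{C}$. Finally $$\mathcal{D}=\{(Y_t,Z_{a,b})\in\mathfrak{a}\times\mathfrak{n}:\ (1-2|a|^2-2|b|)\cos(2t)>(1-\cos(2t))|a|^2\}_0,$$ where $\{\cdot\}_0$ denotes the connected component containing $0$. *)

(* Defs.v *)
From mathcomp Require Import all_boot all_order all_algebra.
From mathcomp Require Import all_classical all_reals all_analysis.
From mathcomp Require Import complex.

Unset Strict Implicit.
Unset Printing Implicit Defensive.

Import Order.TTheory GRing.Theory Num.Theory.
Import numFieldNormedType.Exports.

Local Open Scope classical_set_scope.
Local Open Scope ring_scope.

(* A smooth structure is presented by its sheaf of smooth real functions: the
   open subsets of the carrier, and the functions that are C^oo on an open U
   (values of f outside U are irrelevant).  For manifolds this data is equivalent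
   to a maximal C^oo atlas, and a map is smooth in the sense of charts iff it is
   continuous and pulls smooth local functions back to smooth local functions. *)
Record smooth_space (R : realType) := SmoothSpace {
  spoint : Type;
  carrier : set spoint;
  sopen : set (set spoint);
  smooth_on : set spoint -> (spoint -> R) -> Prop }.
Arguments SmoothSpace {R} spoint carrier sopen smooth_on.
Arguments spoint {R} s.
Arguments carrier {R} s _.
Arguments sopen {R} s _.
Arguments smooth_on {R} s _ _.

Definition smooth_map {R : realType} (A B : smooth_space R)
    (F : spoint A -> spoint B) : Prop :=
  [/\ set_fun (carrier A) (carrier B) F,
      (forall U, sopen B U -> sopen A (carrier A `&` F @^-1` U)) &
      (forall U f, sopen B U -> smooth_on B U f ->
         smooth_on A (carrier A `&` F @^-1` U) (f \o F))].

Definition diffeomorphism {R : realType} (A B : smooth_space R)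
    (F : spoint A -> spoint B) : Prop :=
  smooth_map A B F /\
  exists G : spoint B -> spoint A,
    [/\ smooth_map B A G,
        (forall x, carrier A x -> G (F x) = x) &
        (forall y, carrier B y -> F (G y) = y)].

(* For finite-dimensional V this is the usual class C^k on an open U. *)
Fixpoint class_C {R : realType} {V : normedModType R} (k : nat)
    (U : set V) (f : V -> R) : Prop :=
  (forall x, U x -> {for x, continuous f}) /\
  match k with
  | 0 => True
  | k'.+1 => forall v, (forall x, U x -> derivable f x v) /\
                       class_C k' U (fun x => 'D_v f x)
  end.

Definition linear_space {R : realType} (V : normedModType R) : smooth_space R :=
  SmoothSpace V setT open (fun U f => forall k, class_C k U f).

(* Smooth functions on a subset are those that extend locally to smooth functions
   on the ambient space; for an embedded submanifold (in particular for an open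
   subset) this is its manifold structure. *)
Definition smooth_sub {R : realType} (A : smooth_space R) (S : set (spoint A)) :
    smooth_space R :=
  SmoothSpace (spoint A) (carrier A `&` S)
    [set U | exists2 V, sopen A V & U = V `&` S]
    (fun U f => forall x, U x ->
       exists V g, [/\ sopen A V, V x, smooth_on A V g &
                       forall y, (U `&` V) y -> f y = g y]).

(* The structure pushed forward along p: quotient topology, and f is smooth iff
   f \o p is.  When p is a bijection this is transport of structure; when p is the
   projection of a Lie group onto its cosets by a closed subgroup it is the
   manifold structure of the homogeneous space. *)
Definition smooth_quot {R : realType} (A : smooth_space R) {T : Type}
    (p : spoint A -> T) : smooth_space R :=
  SmoothSpace T (p @` carrier A)
    [set U | U `<=` p @` carrier A /\ sopen A (carrier A `&` p @^-1` U)]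
    (fun U f => smooth_on A (carrier A `&` p @^-1` U) (f \o p)).

Notation Mat R := 'M[R[i]]_3.

(* The pair (real part, imaginary part) of a complex matrix ranges over the real
   normed space Mcoords R, from which Mat R takes its topology and its real
   differentiable structure. *)
Notation Mcoords R := ('M[R]_3 * 'M[R]_3)%type.

Definition of_coords {R : realType} (p : Mcoords R) : Mat R :=
  \matrix_(j, k) (p.1 j k +i* p.2 j k)%C.

Definition of_coords2 {R : realType} (p : Mcoords R * Mcoords R) :
    Mat R * Mat R :=
  (of_coords p.1, of_coords p.2).

Definition of_coords3 {R : realType}
    (p : Mcoords R * (Mcoords R * Mcoords R)) : Mat R * (Mat R * Mat R) :=
  (of_coords p.1, of_coords2 p.2).

Definition Mat_space (R : realType) : smooth_space R :=
  smooth_quot (linear_space (Mcoords R)) of_coords.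

Definition Mat3_space (R : realType) : smooth_space R :=
  smooth_quot (linear_space (Mcoords R * (Mcoords R * Mcoords R))%type)
    of_coords3.

(* Sum of the exponential series, with limits taken entrywise. *)
Definition expm {R : realType} (X : Mat R) : Mat R :=
  let S n : Mat R := \sum_(k < n) (k`!%:R)^-1 *: X ^+ k in
  \matrix_(j, k) (limn (fun n => complex.Re (S n j k)) +i*
                  limn (fun n => complex.Im (S n j k)))%C.

Definition mx3 {T : nzRingType} (rows : seq (seq T)) : 'M[T]_3 :=
  \matrix_(j, k) nth 0 (nth [::] rows j) k.

Definition form_mx (R : realType) : Mat R :=
  mx3 [:: [:: 1; 0; 0];
          [:: 0; 1; 0];
          [:: 0; 0; -1]].

Definition SU21 (R : realType) : set (Mat R) :=
  [set g | (map_mx Num.conj g)^T *m form_mx R *m g = form_mx R /\ \det g = 1].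

Definition SL3C (R : realType) : set (Mat R) := [set g | \det g = 1].

Definition KC (R : realType) : set (Mat R) :=
  [set g | exists (h : 'M[R[i]]_2) (z : 'M[R[i]]_1),
     [/\ h \in unitmx, z \in unitmx, g = block_mx h 0 0 z & \det g = 1]].

Definition elt_a {R : realType} (t : R) : Mat R :=
  let ch := ((expR t + expR (- t)) / 2)%:C%C in
  let sh := ((expR t - expR (- t)) / 2)%:C%C in
  mx3 [:: [:: ch; 0; sh];
          [::  0; 1;  0];
          [:: sh; 0; ch]].

Definition elt_Y {R : realType} (t : R) : Mat R :=
  mx3 [:: [::       0; 0; t%:C%C];
          [::       0; 0;      0];
          [:: t%:C%C; 0;      0]].

Definition elt_Z {R : realType} (a : R[i]) (b : R) : Mat R :=
  let ib := 'i * b%:C%C in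
  mx3 [:: [::    ib; a;  - ib];
          [:: - a^*; 0;   a^*];
          [::    ib; a;  - ib]].

Definition grp_A (R : realType) : set (Mat R) := [set g | exists t, g = elt_a t].

Definition alg_n (R : realType) : set (Mat R) :=
  [set Z | exists a b, Z = elt_Z a b].

Definition grp_N (R : realType) : set (Mat R) := expm @` alg_n R.

Definition grp_NA (R : realType) : set (Mat R) :=
  [set g | exists n a, [/\ grp_N R n, grp_A R a & g = n *m a]].

(* Points of G_C / K_C are the left cosets themselves, as sets of matrices. *)
Definition act {R : realType} (g : Mat R) (x : set (Mat R)) : set (Mat R) :=
  [set g *m h | h in x].

Definition base_point (R : realType) : set (Mat R) := KC R.

Definition XC (R : realType) : smooth_space R :=
  smooth_quot (smooth_sub (Mat_space R) (SL3C R))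
    (fun g : Mat R => act g (base_point R)).

Definition Omega (R : realType) : set (Mat R) :=
  [set Y | exists2 t : R, `|t| < pi / 4 & Y = elt_Y t].

Definition crown (R : realType) : set (set (Mat R)) :=
  [set x | exists g Y, [/\ SU21 R g, Omega R Y &
     x = act (g *m expm ('i *: Y)) (base_point R)]].

Definition Cr (R : realType) : smooth_space R := smooth_sub (XC R) (crown R).

Definition preD (R : realType) : set (Mat R * Mat R) :=
  [set p | exists (t : R) (a : R[i]) (b : R),
     p = (elt_Y t, elt_Z a b) /\
     (1 - 2 * complex.Re `|a| ^+ 2 - 2 * `|b|) * cos (2 * t) >
       (1 - cos (2 * t)) * complex.Re `|a| ^+ 2].

Definition domD (R : realType) : set (Mat R * Mat R) :=
  of_coords2 @` connected_component (of_coords2 @^-1` preD R) 0.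

Definition NAxD (R : realType) : smooth_space R :=
  smooth_sub (Mat3_space R) (grp_NA R `*` domD R).

Definition Phi {R : realType} (p : Mat R * (Mat R * Mat R)) : set (Mat R) :=
  act (p.1 *m expm ('i *: p.2.1) *m expm ('i *: p.2.2)) (base_point R).

(* Main.v *)
Require Import Defs.
From HB Require Import structures.
From mathcomp Require Import all_boot all_order all_algebra.
From mathcomp Require Import all_classical all_reals all_analysis.
From mathcomp Require Import complex ring lra.

Set Implicit Arguments.
Unset Strict Implicit.
Unset Printing Implicit Defensive.

Import Order.TTheory GRing.Theory Num.Theory.
Import numFieldNormedType.Exports.

Local Open Scope classical_set_scope.
Local Open Scope ring_scope.

(** A coset [m K_C] is the same thing as the line of the third column [v] of [m]
    together with the line of the third row [w] of the inverse of [m], with the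
    two scaled so that [w v = 1] ([cosetP]).  The crown consists of the cosets
    for which [v] and [w] are both negative for the Hermitian form
    ([crown_liftP]): it is the product of the complex ball with its conjugate.

    Both balls are seen as Siegel domains.  In the coordinates
    [p = v1 + v3], [s = v2], [q = v3 - v1], negativity reads
    [Re (p q^* ) > |s|^2]; the group [N] fixes [q] and acts on the affine
    coordinates [p/q], [s/q] by Heisenberg translations, and [A] acts by
    dilations.  Let [p1, s1] be the affine coordinates of [v], and [P2, S2] the
    dual affine coordinates of [w].  The normalization [w v = 1] becomes
      [(p1 + P2) / 2 - s1 S2 = 1 / (q Q)],
    and for negative [v] and [w] this number has positive real part
    ([siegel_half_plane]).  At the point [n a_r exp(i Y_t) exp(i Z_(a,b)) x_0]
    it equals [exp (2 (r + i t))].  Hence the polar coordinates of the right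
    half-plane give back [r] and [t], with [|t| < pi/4] ([polar_of_half_plane],
    [half_plane_of_polar]).  Once [r] and [t] are known, [s1] and [S2] are
    linear in the complex parameters of [exp(i Z_(a,b))] and of [n], and
    [p1 - P2] is affine in the two remaining real ones, so everything is
    determined by explicit formulas ([chart_decode], [dec_al_chart],
    [dec_a_chart], [dec_bbe_chart]).  Since [NA] preserves the Hermitian form,
    the inequality that defines [D] says exactly that the column and the row
    of the point are negative ([herm_chart], [crown_lift_chart]); the component
    of 0 is the part [|t| < pi/4], which is star-shaped ([domDP]).

    The map and its inverse are therefore given, on matrices representing the
    cosets, by elementary functions of the entries.  Their smoothness descends
    to the quotient and to the subsets by formal properties of sheaves of smooth
    functions, and in coordinates it rests on the chain rule for [class_C]
    ([class_C_comp]), which is deduced from the mean value theorem. *)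

(** * Functions of class C^k *)

Section ClassC.
Context {R : realType} {V : normedModType R}.
Implicit Types (U : set V) (f g : V -> R) (k : nat).

Lemma class_C_cont k U f x : class_C k U f -> U x -> {for x, continuous f}.
Proof. by case: k => [|k] [cf _] /cf. Qed.

Lemma class_C_derivable k U f x v : class_C k.+1 U f -> U x -> derivable f x v.
Proof. by move=> [_ /(_ v)[df _]] /df. Qed.

Lemma class_C_derive k U f v : class_C k.+1 U f -> class_C k U ('D_v f).
Proof. by move=> [_ /(_ v)[_ +]]. Qed.

Lemma class_CW k U f : class_C k.+1 U f -> class_C k U f.
Proof.
elim: k f => [|k IH] f cf; first by case: cf.
split; first by case: cf.
move=> v; split => [x Ux|]; first exact: class_C_derivable cf Ux.
by apply: IH; exact: class_C_derive.
Qed.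

Lemma sub_class_C k U U' f : U' `<=` U -> class_C k U f -> class_C k U' f.
Proof.
move=> sub; elim: k f => [|k IH] f [cf Hf]; split=> //; try by move=> x /sub/cf.
by move=> v; have [df Df] := Hf v; split=> [x /sub/df//|]; exact: IH.
Qed.

Lemma eq_class_C k U f g : open U -> (forall x, U x -> f x = g x) ->
  class_C k U f -> class_C k U g.
Proof.
move=> oU; elim: k f g => [|k IH] f g fg [cf Hf].
  split=> // x Ux; change (g y @[y --> x] --> g x); rewrite -(fg x Ux).
  apply: cvg_trans (cf x Ux); apply: near_eq_cvg.
  by near=> y; apply: fg; near: y; exact: open_nbhs_nbhs.
split=> [x Ux|v].
  change (g y @[y --> x] --> g x); rewrite -(fg x Ux); apply: cvg_trans (cf x Ux); apply: near_eq_cvg.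
  by near=> y; apply: fg; near: y; exact: open_nbhs_nbhs.
have nfg x : U x -> \near x, f x = g x.
  by move=> Ux; near=> y; apply: fg; near: y; exact: open_nbhs_nbhs.
have [df Df] := Hf v; split=> [x Ux|].
  by apply: near_eq_derivable (df x Ux); exact: nfg.
by apply: IH Df => x Ux; apply: near_eq_derive; exact: nfg.
Unshelve. all: by end_near. Qed.

Lemma class_C_cst k U (c : R) : class_C k U (fun=> c).
Proof.
elim: k c => [|k IH] c; split=> //; try by move=> x _; exact: cvg_cst.
move=> v; split=> [x _|]; first exact: derivable_cst.
have -> : (fun x : V => 'D_v (fun=> c) x) = (fun=> 0); last exact: IH.
by apply/funext=> x; exact: derive_cst.
Qed.

Lemma class_C_linear k U (l : V -> R) :
  linear l -> continuous l -> class_C k U l.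
Proof.
move=> linl cl; pose linM := GRing.isLinear.Build _ _ _ _ _ linl.
pose L : {linear V -> R} := HB.pack l linM.
case: k => [|k]; split=> //; try by move=> x _; exact: cl.
have dl x : differentiable l x by exact: (@linear_differentiable R V R L).
move=> v; split=> [x _|]; first exact: diff_derivable.
have -> : (fun x : V => 'D_v l x) = (fun=> l v); last exact: class_C_cst.
by apply/funext => x; rewrite deriveE// (@diff_lin R V R L).
Qed.

Lemma class_CD k U f g : open U ->
  class_C k U f -> class_C k U g -> class_C k U (fun x => f x + g x).
Proof.
move=> oU; elim: k f g => [|k IH] f g [cf Hf] [cg Hg]; split=> //;
  try by move=> x Ux; apply: cvgD; [exact: cf | exact: cg].
move=> v; have [df Df] := Hf v; have [dg Dg] := Hg v; split=> [x Ux|].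
  by apply: derivableD; [exact: df | exact: dg].
apply: eq_class_C (IH _ _ Df Dg) => // x Ux.
by rewrite deriveD; [|exact: df | exact: dg].
Qed.

Lemma class_CM k U f g : open U ->
  class_C k U f -> class_C k U g -> class_C k U (fun x => f x * g x).
Proof.
move=> oU; elim: k f g => [|k IH] f g Cf Cg.
  by split=> // x Ux; apply: cvgM; [exact: (class_C_cont Cf) | exact: (class_C_cont Cg)].
split=> [x Ux|v].
  by apply: cvgM; [exact: (class_C_cont Cf) | exact: (class_C_cont Cg)].
split=> [x Ux|].
  by apply: derivableM; [exact: (class_C_derivable Cf Ux) | exact: (class_C_derivable Cg Ux)].
apply: (@eq_class_C _ _ (fun x => f x * 'D_v g x + g x * 'D_v f x)) => //.
  move=> x Ux; rewrite deriveM//; [exact: (class_C_derivable Cf Ux) | exact: (class_C_derivable Cg Ux)].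
by apply: class_CD => //; apply: IH; try exact: class_CW; exact: class_C_derive.
Qed.

Lemma class_CN k U f : open U -> class_C k U f -> class_C k U (fun x => - f x).
Proof.
move=> oU Cf; have -> : (fun x : V => - f x) = (fun x => -1 * f x); last first.
  by apply: class_CM => //; exact: class_C_cst.
by apply/funext => x; rewrite mulN1r.
Qed.

Lemma class_C_sum k U (I : Type) (s : seq I) (P : pred I) (F : I -> V -> R) :
  open U -> (forall i, P i -> class_C k U (F i)) ->
  class_C k U (fun x => \sum_(i <- s | P i) F i x).
Proof.
move=> oU CF; elim: s => [|i s IH].
  have -> : (fun x => \sum_(i <- [::] | P i) F i x) = fun=> 0.
    by apply/funext => x; rewrite big_nil.
  exact: class_C_cst.
have -> : (fun x => \sum_(j <- i :: s | P j) F j x) =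
    fun x => (if P i then F i x else 0) + \sum_(i <- s | P i) F i x.
  by apply/funext => x; rewrite [LHS]big_cons; case: ifP => _; rewrite ?add0r.
apply: class_CD => //; case Pi: (P i); first exact: CF.
exact: class_C_cst.
Qed.

End ClassC.

(** In one variable a single derivative gives all the directional ones, by
    homogeneity, so smoothness follows by iterating this on a formula for the
    derivative. *)
Lemma class_C1 {R : realType} k (U : set R) (f g : R -> R) : open U ->
  (forall x, U x -> is_derive x 1 f (g x)) ->
  class_C k U g -> class_C k.+1 U f.
Proof.
move=> oU fg Cg.
have df x : U x -> differentiable f x.
  by move=> /fg ?; apply/derivable1_diffP.
split=> [x /df|v]; first exact: differentiable_continuous.
split=> [x /df|]; first exact: diff_derivable.
apply: (@eq_class_C _ _ k U (fun x => v * g x)) => //.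
  move=> x Ux; rewrite deriveE; last exact: df.
  rewrite diff1E; last exact: df.
  by rewrite derive1E; have := fg x Ux => /(@derive_val _ _ _ _ _ _ _) ->.
by apply: class_CM => //; exact: class_C_cst.
Qed.

Section MeanValue.
Context {R : realType} {V : normedModType R}.
Implicit Types (f : V -> R) (x e : V) (d : R).

(** The increment [d] may be negative, which the usual statement on an interval
    excludes. *)
Lemma mean_value_line f x e d :
  (forall s, `|s| <= `|d| -> derivable f (x + s *: e) e) ->
  exists2 s, `|s| <= `|d| & f (x + d *: e) - f x = d * 'D_e f (x + s *: e).
Proof.
move=> df; pose p (s : R) := f (x + s *: e).
have dp (s : R) : `|s| <= `|d| -> is_derive s (1 : R) p ('D_e f (x + s *: e)).
  move=> /df dfs.
  have E : (fun h : R => p (h *: 1 + s)) = (fun h : R => f (h *: e + (x + s *: e))).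
    apply/funext => h; rewrite /p; congr f.
    by rewrite scalerDl [_%:A]mulr1 addrCA.
  apply: DeriveDef.
    apply/derivable1P; rewrite E; by move/derivable1P : dfs.
  rewrite /derive; congr (lim (_ @ 0^')).
  by apply: (eq_fun (fun h => congr1 (fun u => h^-1 *: (u - p s)) (congr1 (@^~ h) E))).
have cp a b : (forall s, s \in `[a, b]%R -> `|s| <= `|d|) ->
    {within `[a, b], continuous p}.
  by move=> ab; apply: derivable_within_continuous => s /ab /dp ?; exact: ex_derive.
have p0 : p 0 = f x by rewrite /p scale0r addr0.
have [d0|d0] := leP 0 d.
  have H s : s \in `[0, d]%R -> `|s| <= `|d|.
    by rewrite in_itv/= => /andP[s0 sd]; rewrite !ger0_norm.
  have [|s /H sd] := @MVT_segment R p (fun s => 'D_e f (x + s *: e)) 0 d d0 _ (cp _ _ H).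
    by move=> s /subset_itv_oo_cc/H/dp.
  by rewrite p0 subr0 => E; exists s => //; rewrite mulrC -E.
have H s : s \in `[d, 0]%R -> `|s| <= `|d|.
  by rewrite in_itv/= => /andP[ds s0]; rewrite !ler0_norm ?lerN2// ltW.
have [|s /H sd] := @MVT_segment R p (fun s => 'D_e f (x + s *: e)) d 0 (ltW d0) _ (cp _ _ H).
  by move=> s /subset_itv_oo_cc/H/dp.
rewrite p0 sub0r => E; exists s => //.
by rewrite -[LHS]opprB E mulrN opprK mulrC.
Qed.

(** One coordinate step of the chain rule.  The base point [z h] moves with
    [h], so existence of the derivative at [y] alone would not be enough: the
    mean value theorem trades the increment for a derivative at a point tending
    to [y], where the derivative is continuous. *)
Lemma cvg_growth_rate_line f (O : set V) y e (z : R -> V) (d : R -> R) d' :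
  open O -> O y -> (forall x, O x -> derivable f x e) ->
  {for y, continuous ('D_e f)} ->
  z h @[h --> 0^'] --> y -> d h @[h --> 0^'] --> 0 ->
  h^-1 * d h @[h --> 0^'] --> d' ->
  h^-1 * (f (z h + d h *: e) - f (z h)) @[h --> 0^'] --> d' * 'D_e f y.
Proof.
move=> oO Oy df cDf cz cd cd'.
have /choice[s Hs] : forall h, exists s, `|s| <= `|d h| /\
    ((forall s, `|s| <= `|d h| -> O (z h + s *: e)) ->
     f (z h + d h *: e) - f (z h) = d h * 'D_e f (z h + s *: e)).
  move=> h; have [Oh|nOh] := pselect (forall s, `|s| <= `|d h| -> O (z h + s *: e)).
    have [s sd E] := @mean_value_line f (z h) e (d h) (fun s sd => df _ (Oh s sd)).
    by exists s.
  by exists 0; rewrite normr0.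
have cs : s h @[h --> 0^'] --> 0.
  apply/norm_cvg0P; apply: (@squeeze_cvgr _ _ _ _ (cst 0) (fun h => `|d h|)).
  - by near=> h; rewrite normr_ge0/=; case: (Hs h).
  - exact: cvg_cst.
  - by apply/norm_cvg0P.
have czs (s' : R -> R) : s' h @[h --> 0^'] --> 0 ->
    z h + s' h *: e @[h --> 0^'] --> y.
  move=> c; rewrite -[y]addr0 -(scale0r e); apply: cvgD => //.
  by apply: cvgZl.
have : h^-1 * d h * 'D_e f (z h + s h *: e) @[h --> 0^'] --> d' * 'D_e f y.
  apply: cvgM => //.
  exact: (@continuous_cvg _ _ _ _ _ (fun h => z h + s h *: e) ('D_e f) y cDf (czs _ cs)).
apply: cvg_trans; apply: near_eq_cvg.
have /nbhs_ballP[r /= r0 rO] : nbhs y O by exact: open_nbhs_nbhs.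
near=> h; case: (Hs h) => _ ->; first by rewrite mulrA.
move=> t td; apply: rO; rewrite -ball_normE /ball_ /=.
rewrite opprD addrA (le_lt_trans (ler_normB _ _))// normrZ.
have : `|y - z h| < r / 2.
  by near: h; move/cvgrPdist_lt : cz; apply; rewrite divr_gt0//.
have : `|d h| * `|e| < r / 2.
  near: h; have : `|d h| * `|e| @[h --> 0^'] --> 0.
    by rewrite -[X in _ --> X](mul0r `|e|); apply: cvgM; [by apply/norm_cvg0P | exact: cvg_cst].
  by move=> /cvgrPdist_lt/(_ (r/2)); rewrite divr_gt0// => /(_ isT);
    apply: filterS => u; rewrite sub0r normrN normrM !normr_id.
have := ler_wpM2r (normr_ge0 e) td.
lra.
Unshelve. all: by end_near. Qed.

End MeanValue.

(** * The chain rule *)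

(** Stands for finite dimension, in a form that is stable under products. *)
Definition coord_system {R : realType} (V : normedModType R) (I : finType)
    (e : I -> V) (l : I -> V -> R) : Prop :=
  (forall i, linear (l i) /\ continuous (l i)) /\
  (forall v, v = \sum_i l i v *: e i).

Section ChainRule.
Context {R : realType} {W V : normedModType R} {I : finType}.
Variables (e : I -> V) (l : I -> V -> R).
Hypothesis coord : coord_system e l.
Implicit Types (f : V -> R) (F : W -> V).

Let lB i u v : l i (u - v) = l i u - l i v.
Proof.
have [linl _] := coord.1 i.
by rewrite -[- v]scaleN1r addrC linl scaleN1r addrC.
Qed.

Lemma coord_continuous_at F x : (forall i, {for x, continuous (l i \o F)}) ->
  {for x, continuous F}.
Proof.
move=> cF.
have -> : F = fun y => \sum_i (l i \o F) y *: e i.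
  by apply/funext => y; exact: coord.2.
apply: cvg_big => [|i _]; first exact: add_continuous.
by apply: cvgZl; exact: cF.
Qed.

(** The increment of [F] is written as a sum of increments along the basis
    vectors, which are added one at a time; each contributes one term of the sum
    by [cvg_growth_rate_line]. *)
Lemma is_derive_chain f (O : set V) F x v : open O -> O (F x) ->
  (forall i y, O y -> derivable f y (e i)) ->
  (forall i, {for F x, continuous ('D_(e i) f)}) ->
  (forall i, derivable (l i \o F) x v) ->
  is_derive x v (f \o F) (\sum_i 'D_v (l i \o F) x * 'D_(e i) f (F x)).
Proof.
move=> oO OFx df cDf dF.
pose y := F x; pose d i (h : R) := l i (F (h *: v + x)) - l i y.
have cd' i : h^-1 * d i h @[h --> 0^'] --> 'D_v (l i \o F) x by exact: dF.
have cd i : d i h @[h --> 0^'] --> 0.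
  have : h * (h^-1 * d i h) @[h --> 0^'] --> 0 * 'D_v (l i \o F) x.
    apply: cvgM (cd' i); exact: nbhs_dnbhs.
  rewrite mul0r; apply: cvg_trans; apply: near_eq_cvg.
  near=> h; rewrite mulrA mulfV ?mul1r//; near: h; exact: nbhs_dnbhs_neq.
have FE h : F (h *: v + x) = y + \sum_i d i h *: e i.
  rewrite [LHS](_ : _ = y + (F (h *: v + x) - y)); last by rewrite [RHS]addrC subrK.
  by congr (_ + _); rewrite [LHS]coord.2; apply: eq_bigr => i _; rewrite lB.
have key (s : seq I) :
    (y + \sum_(i <- s) d i h *: e i @[h --> 0^'] --> y) /\
    (h^-1 * (f (y + \sum_(i <- s) d i h *: e i) - f y) @[h --> 0^'] -->
       \sum_(i <- s) 'D_v (l i \o F) x * 'D_(e i) f y).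
  elim: s => [|i s [IHc IHd]].
    split.
      under eq_cvg do rewrite big_nil addr0; exact: cvg_cst.
    under eq_cvg do rewrite big_nil addr0 subrr mulr0.
    rewrite big_nil; exact: cvg_cst.
  have E h : y + \sum_(j <- i :: s) d j h *: e j =
      (y + \sum_(j <- s) d j h *: e j) + d i h *: e i.
    by rewrite big_cons addrCA addrC.
  split.
    have : (y + \sum_(j <- s) d j h *: e j) + d i h *: e i @[h --> 0^'] -->
        y + 0 *: e i by apply: cvgD => //; apply: cvgZl.
    rewrite scale0r addr0; apply: cvg_trans; apply: near_eq_cvg.
    by near=> h; rewrite /= E.
  rewrite big_cons.
  have := cvgD (cvg_growth_rate_line oO OFx (df i) (cDf i) IHc (cd i) (cd' i)) IHd.
  move=> /(_ _); apply: cvg_trans; apply: near_eq_cvg; near=> h.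
  by rewrite /= E -mulrDr addrA subrK.
have /cvgP := (key (index_enum I)).2.
have : (fun h : R => h^-1 * (f (y + \sum_i d i h *: e i) - f y)) =
   (fun h => h^-1 *: (((f \o F) \o shift x) (h *: v) - (f \o F) x)).
  by apply/funext => h; rewrite /= -FE.
move=> E; have [_] := key (index_enum I); rewrite E => c.
by move=> ?; apply: DeriveDef => //; exact: cvg_lim c.
Unshelve. all: by end_near. Qed.

(** By induction on [k]: the chain rule writes the derivative of the composite
    as a sum of products, to which the induction hypothesis and [class_CM]
    apply. *)
Lemma class_C_comp k (U : set W) (O : set V) f F : open U -> open O ->
  (forall x, U x -> O (F x)) ->
  (forall i, class_C k U (l i \o F)) -> class_C k O f -> class_C k U (f \o F).
Proof.
move=> oU oO UO.
have cFF k' : (forall i, class_C k' U (l i \o F)) ->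
    forall x, U x -> {for x, continuous F}.
  move=> CF x Ux; apply: coord_continuous_at => i.
  exact: class_C_cont (CF i) Ux.
elim: k f => [|k IH] f CF Cf.
  split=> // x Ux; apply: continuous_comp; first exact: (cFF 0%N).
  by apply: class_C_cont Cf _; exact: UO.
split=> [x Ux|v].
  apply: continuous_comp; first exact: (cFF k.+1).
  by apply: class_C_cont Cf _; exact: UO.
have D x : U x -> is_derive x v (f \o F)
    (\sum_i 'D_v (l i \o F) x * 'D_(e i) f (F x)).
  move=> Ux; apply: (@is_derive_chain _ O) => //; first exact: UO.
  - by move=> i y Oy; exact: class_C_derivable Cf Oy.
  - by move=> i; exact: (class_C_cont (class_C_derive (e i) Cf) (UO x Ux)).
  - by move=> i; exact: class_C_derivable (CF i) Ux.
split=> [x /D ?|]; first exact: ex_derive.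
apply: (@eq_class_C _ _ _ _ (fun x => \sum_i 'D_v (l i \o F) x * 'D_(e i) f (F x))) => //.
  by move=> x /D ?; rewrite derive_val.
apply: class_C_sum => // i _; apply: class_CM => //.
  exact: class_C_derive v (CF i).
apply: (IH ('D_(e i) f)); last exact: class_C_derive.
by move=> j; exact: class_CW.
Qed.

End ChainRule.

Section CoordSystems.
Context {R : realType}.

Lemma coord_system_real :
  @coord_system R R unit (fun=> 1) (fun=> id).
Proof.
split=> [_|v]; first by split=> // x; exact: cvg_id.
by rewrite big_const card_unit /= addr0 [_ *: _]mulr1.
Qed.

Lemma coord_system_matrix m n : @coord_system R 'M[R]_(m.+1, n.+1)
  ('I_m.+1 * 'I_n.+1)%type (fun i => delta_mx i.1 i.2) (fun i A => A i.1 i.2).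
Proof.
split=> [i|v]; last by rewrite {1}[v]matrix_sum_delta pair_big.
split=> [a A B|]; first by rewrite !mxE.
exact: coord_continuous.
Qed.

Lemma coord_system_pair (V1 V2 : normedModType R) (I1 I2 : finType) e1 l1 e2 l2 :
  @coord_system R V1 I1 e1 l1 -> @coord_system R V2 I2 e2 l2 ->
  @coord_system R (V1 * V2)%type (I1 + I2)%type
    (fun i => match i with inl i => (e1 i, 0) | inr i => (0, e2 i) end)
    (fun i v => match i with inl i => l1 i v.1 | inr i => l2 i v.2 end).
Proof.
move=> [H1 s1] [H2 s2]; split=> [[i|i]|[v1 v2]].
- have [lin cont] := H1 i; split=> [a u v|x]; first exact: lin.
  by apply: continuous_comp; [exact: cvg_fst | exact: cont].
- have [lin cont] := H2 i; split=> [a u v|x]; first exact: lin.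
  by apply: continuous_comp; [exact: cvg_snd | exact: cont].
rewrite big_sumType /=.
have p1 (I : finType) (c : I -> R) (e : I -> V1) :
    \sum_i c i *: ((e i, 0) : (V1 * V2)%type) = (\sum_i c i *: e i, 0).
  apply: (big_ind2 (fun (a : (V1 * V2)%type) b => a = (b, 0))) => //.
    by move=> _ u1 _ u2 -> ->; congr (_, _); rewrite /= addr0.
  by move=> i _; congr (_, _); rewrite /= scaler0.
have p2 (I : finType) (c : I -> R) (e : I -> V2) :
    \sum_i c i *: ((0, e i) : (V1 * V2)%type) = (0, \sum_i c i *: e i).
  apply: (big_ind2 (fun (a : (V1 * V2)%type) b => a = (0, b))) => //.
    by move=> _ u1 _ u2 -> ->; congr (_, _); rewrite /= addr0.
  by move=> i _; congr (_, _); rewrite /= scaler0.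
by rewrite p1 p2 -s1 -s2; congr (_, _); rewrite /= ?addr0 ?add0r.
Qed.

End CoordSystems.

(** * Maps between smooth spaces *)

Section SmoothSpaces.
Context {R : realType}.
Implicit Types A B C : smooth_space R.

(** Restriction to an open subset.  Unlike for [smooth_sub], no extension of
    functions is involved, so maps out of it are easier to build. *)
Definition smooth_open A (S : set (spoint A)) : smooth_space R :=
  SmoothSpace (spoint A) (carrier A `&` S)
    [set U | sopen A U /\ U `<=` S] (smooth_on A).

Arguments smooth_open A S : clear implicits.

Lemma smooth_map_comp A B C F G :
  smooth_map A B F -> smooth_map B C G -> smooth_map A C (G \o F).
Proof.
move=> [AB oF sF] [BC oG sG].
have E U : carrier A `&` F @^-1` (carrier B `&` G @^-1` U) =
    carrier A `&` (G \o F) @^-1` U.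
  apply/seteqP; split=> x /=; first by case=> ? [].
  by case=> Ax ?; split=> //; split=> //; exact: AB.
split=> [x /AB/BC //|U /oG/oF|U f oU sf]; first by rewrite E.
by rewrite -E; apply: (sF _ (f \o G)); [exact: oG | exact: sG].
Qed.

Lemma smooth_quot_proj A (T : Type) (p : spoint A -> T) :
  smooth_map A (smooth_quot A p) p.
Proof. by split=> [x Ax|U [_]|U f]; first by exists x. Qed.

Lemma smooth_map_quot A B (T : Type) (p : spoint A -> T) F :
  smooth_map A B (F \o p) -> smooth_map (smooth_quot A p) B F.
Proof.
move=> [AB oF sF].
have E U : carrier A `&` p @^-1` (p @` carrier A `&` F @^-1` U) =
    carrier A `&` (F \o p) @^-1` U.
  apply/seteqP; split=> x /=; first by case=> ? [].
  by case=> Ax ?; split=> //; split=> //; exists x.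
split=> [_ [x Ax <-]|U oU|U f oU sf]; first exact: (AB x).
  by split=> [x []//|]; rewrite E; exact: oF.
rewrite /= E; exact: sF oU sf.
Qed.

Lemma smooth_map_quot_open A B (T : Type) (p : spoint A -> T) (S : set T) F :
  smooth_map (smooth_open A (p @^-1` S)) B (F \o p) ->
  smooth_map (smooth_open (smooth_quot A p) S) B F.
Proof.
move=> [AB oF sF].
have E U : carrier A `&` p @^-1` (p @` carrier A `&` S `&` F @^-1` U) =
    carrier A `&` p @^-1` S `&` (F \o p) @^-1` U.
  apply/seteqP; split=> x /=; first by case=> ? [[]].
  by case=> [[Ax ? ?]]; split=> //; split=> //; split=> //; exists x.
split=> [_ [[x Ax <-] Sx]|U oU|U f oU sf]; first by apply: (AB x).
  split=> [|x [[]]//]; split=> [x [[]]//|].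
  by rewrite E; have [] := oF U oU.
by have := sF U f oU sf; rewrite /= E.
Qed.

(** A function on an open subset is its own extension. *)
Lemma smooth_map_sub_of_open A B (S : set (spoint A)) F :
  smooth_map (smooth_open A S) B F -> smooth_map (smooth_sub A S) B F.
Proof.
move=> [AB oF sF]; split=> [//|U /oF[? ?]|U f oU sf x Ux].
  by exists (carrier A `&` S `&` F @^-1` U) => //; apply/esym/setIidPl.
exists (carrier A `&` S `&` F @^-1` U), (f \o F).
by split=> //; [have [] := oF U oU | exact: sF].
Qed.

(** This is how a map [F'] on a subset [S] is obtained from an ambient
    map [F]: only their agreement on [S] matters. *)
Lemma smooth_map_open_sub A B (O S T : set (spoint A)) F F' :
  smooth_map (smooth_open A O) B F ->
  (forall x, carrier A x -> S x -> T x <-> O x) ->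
  (forall x, carrier A x -> S x -> O x -> F' x = F x) ->
  smooth_map (smooth_open (smooth_sub A S) T) B F'.
Proof.
move=> [AB oF sF] TO FF'.
have E U : carrier A `&` S `&` T `&` F' @^-1` U =
    carrier A `&` O `&` F @^-1` U `&` S.
  apply/seteqP; split=> x /=.
    case=> [[[Ax Sx] Tx] Ux]; have Ox : O x by apply/TO.
    by rewrite -FF'.
  case=> [[[Ax Ox] Ux] Sx]; have Tx : T x by apply/TO.
  by rewrite FF'.
split=> [x [[Ax Sx] Tx]|U oU|U f oU sf x].
- have Ox : O x by apply/TO.
  by rewrite FF'//; exact: AB.
- split=> [|x [[]]//]; exists (carrier A `&` O `&` F @^-1` U); last exact: E.
  by have [] := oF U oU.
move=> Hx; have [Vx Sx] : (carrier A `&` O `&` F @^-1` U `&` S) x by rewrite -E.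
exists (carrier A `&` O `&` F @^-1` U), (f \o F).
split=> //; [by have [] := oF U oU | exact: sF U f oU sf |].
by move=> y [[[[Ay Sy] Ty] _] [[_ Oy] _]]; rewrite /= FF'.
Qed.

Lemma smooth_map_restrict A B (S : set (spoint A)) (T : set (spoint B)) F :
  smooth_map A B F -> set_fun (carrier A `&` S) T F ->
  smooth_map (smooth_sub A S) (smooth_sub B T) F.
Proof.
move=> [AB oF sF] ST; split=> [x Sx|_ [V oV ->]|U f _ sf x].
- by split; [apply: AB; case: Sx | exact: ST].
- exists (carrier A `&` F @^-1` V); first exact: oF.
  apply/seteqP; split=> x /=; first by case=> [[? ?] []].
  by case=> [[? ?] ?]; split=> //; split=> //; exact: ST.
case=> Sx /sf[V [g [oV Vx sg fg]]].
exists (carrier A `&` F @^-1` V), (g \o F).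
split=> [||//|y /= [[_ ?] [_ ?]]]; [exact: oF| |exact: sF|exact: fg].
by split=> //; case: Sx.
Qed.

(** The part of the sheaf axioms that is needed to shrink the neighbourhood on
    which a local extension is defined. *)
Definition presheaf A : Prop :=
  (forall U V, sopen A U -> sopen A V -> sopen A (U `&` V)) /\
  (forall U V f, sopen A U -> sopen A V -> V `<=` U -> smooth_on A U f ->
     smooth_on A V f).

Lemma presheaf_quot A (T : Type) (p : spoint A -> T) :
  presheaf A -> presheaf (smooth_quot A p).
Proof.
move=> [oI sS]; split=> [U V [pU oU] [pV oV]|U V f [_ oU] [_ oV] VU].
  split=> [x [/pU]//|].
  have -> : carrier A `&` p @^-1` (U `&` V) =
    (carrier A `&` p @^-1` U) `&` (carrier A `&` p @^-1` V) by
    rewrite preimage_setI setIIr.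
  exact: oI.
by apply: sS => // x [Ax /VU Ux].
Qed.

Lemma presheaf_sub A (S : set (spoint A)) : presheaf A -> presheaf (smooth_sub A S).
Proof.
move=> [oI sS]; split=> [_ _ [U oU ->] [V oV ->]|U V f _ _ VU sf x /VU/sf].
  by exists (U `&` V); [exact: oI | rewrite setIACA setIid].
move=> [W [g [oW Wx sg fg]]]; exists W, g; split=> // y [/VU Uy Wy].
exact: fg.
Qed.

Lemma smooth_map_corestrict A B (S : set (spoint A)) (T : set (spoint B)) F :
  presheaf A -> smooth_map (smooth_sub A S) B F ->
  set_fun (carrier A `&` S) T F ->
  smooth_map (smooth_sub A S) (smooth_sub B T) F.
Proof.
move=> [oI sS] [AB oF sF] ST.
split=> [x Sx|_ [V oV ->]|U f _ sf x].
- by split; [exact: AB | exact: ST].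
- have [W oW E] := oF V oV; exists W => //; rewrite -E.
  apply/seteqP; split=> x /=; first by case=> [? []].
  by case=> ? ?; split=> //; split=> //; exact: ST.
case=> Sx /sf[V [g [oV Vx sg fg]]].
have [W oW EW] := oF V oV.
have /(_ x)[|W' [h [oW' W'x sh gh]]] := sF V g oV sg; first by split.
have Wx : W x by have [] : (W `&` S) x by rewrite -EW; split.
exists (W' `&` W), h; split=> //.
- exact: oI.
- by apply: (sS W') => //; exact: oI.
move=> y [[Sy Uy] [W'y Wy]].
have VFy : (carrier A `&` S `&` F @^-1` V) y.
  by rewrite EW; split=> //; case: Sy.
rewrite -gh//; apply: fg; split=> //; by case: VFy.
Qed.

Lemma eq_smooth_map_sub A B (S : set (spoint A)) F F' :
  (forall x, carrier A x -> S x -> F x = F' x) ->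
  smooth_map (smooth_sub A S) B F -> smooth_map (smooth_sub A S) B F'.
Proof.
move=> FF' [AB oF sF].
have E U : carrier A `&` S `&` F' @^-1` U = carrier A `&` S `&` F @^-1` U.
  by apply/seteqP; split=> x /= [[Ax Sx]]; [rewrite -FF' | rewrite FF'].
split=> [x Sx|U oU|U f oU sf x].
- by rewrite -FF'; [exact: AB | case: Sx..].
- by rewrite /= E; exact: oF.
move=> Hx; have Sx : (carrier A `&` S `&` F @^-1` U) x by rewrite -E.
have [V [g [oV Vx sg fg]]] := sF U f oU sf x Sx.
exists V, g; split=> // y [Uy Vy].
have Uy' : (carrier A `&` S `&` F @^-1` U) y by rewrite -E.
by rewrite -fg//; case: Uy' => -[Ay Sy] _; rewrite /= FF'.
Qed.

End SmoothSpaces.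
Arguments smooth_open {R} A S.

Lemma presheaf_linear {R : realType} (V : normedModType R) :
  presheaf (linear_space V).
Proof.
split=> [U W oU oW|U W f _ _ WU sf k]; first exact: openI.
exact: sub_class_C WU (sf k).
Qed.

Lemma smooth_map_linear {R : realType} (V1 V2 : normedModType R) (I : finType)
    (e : I -> V2) (l : I -> V2 -> R) (U : set V1) (F : V1 -> V2) :
  coord_system e l -> open U -> (forall i k, class_C k U (l i \o F)) ->
  smooth_map (smooth_open (linear_space V1) U) (linear_space V2) F.
Proof.
move=> coord oU sF.
have cF x : U x -> {for x, continuous F}.
  by move=> Ux; apply: (coord_continuous_at coord) => i; exact: class_C_cont (sF i 0%N) Ux.
have oUF W : open W -> open (setT `&` U `&` F @^-1` W).
  move=> oW; rewrite setTI openE => x [Ux Wx]; apply: filterI.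
    exact: open_nbhs_nbhs.
  by apply: (cF x Ux); exact: open_nbhs_nbhs.
split=> [//|W oW|W f oW sf k] /=.
  by split; [exact: oUF | move=> x [[]]].
apply: (class_C_comp coord _ oW); [exact: oUF|by move=> x []| |exact: sf].
by move=> i; apply: sub_class_C (sF i k) => x [[]].
Qed.

(** * Elementary smooth functions *)

Definition smooth {R : realType} {V : normedModType R} (U : set V) (f : V -> R) :=
  forall k, class_C k U f.

Section OneVariable.
Context {R : realType}.
Implicit Types (U : set R) (f : R -> R).

Lemma class_C0_derivable U f g : (forall x, U x -> is_derive x 1 f (g x)) ->
  class_C 0 U f.
Proof.
move=> fg; split=> // x /fg ?.
by apply/differentiable_continuous/derivable1_diffP.
Qed.

Lemma smooth_expR : smooth setT (@expR R).
Proof.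
have oT : open [set: R] by exact: openT.
elim=> [|k IH]; first exact: (class_C0_derivable (fun x _ => is_derive_expR x)).
exact: (class_C1 oT (fun x _ => is_derive_expR x) IH).
Qed.

(** The derivatives exchange the two functions, so the induction has to treat
    both at once. *)
Lemma smooth_cos_sin k : class_C k setT (@cos R) /\ class_C k setT (@sin R).
Proof.
elim: k => [|k [IHc IHs]].
  by split; apply: class_C0_derivable.
have oT : open [set: R] by exact: openT.
split.
  exact: (class_C1 oT (fun x _ => is_derive_cos x) (class_CN oT IHs)).
exact: (class_C1 oT (fun x _ => is_derive_sin x) IHc).
Qed.

Lemma open_neq0 : open [set x : R | x != 0].
Proof. exact: open_neq. Qed.

Lemma smooth_inv : smooth [set x : R | x != 0] (fun x => x^-1).
Proof.
have dinv x : [set x : R | x != 0] x ->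
    is_derive x 1 (fun x : R => x^-1) (- (x^-1 * x^-1)).
  move=> x0; have did : derivable (fun y : R => y) x 1 by exact: derivable_id.
  apply: DeriveDef; first exact: derivableV.
  by rewrite deriveV// derive_id [_ *: _]mulr1 expr2 invfM.
elim=> [|k IH]; first exact: class_C0_derivable dinv.
apply: (class_C1 open_neq0 dinv).
by apply: class_CN open_neq0 _; apply: class_CM open_neq0 _ _.
Qed.

Lemma smooth_ln : smooth [set x : R | 0 < x] (@ln R).
Proof.
have dln x : [set x : R | 0 < x] x -> is_derive x 1 (@ln R) x^-1.
  by move=> /= x0; exact: is_derive1_ln.
have o0 : open [set x : R | 0 < x] by exact: open_gt.
case=> [|k]; first exact: class_C0_derivable dln.
apply: (class_C1 o0 dln); apply: sub_class_C (smooth_inv k) => x /= x0.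
by rewrite gt_eqF.
Qed.

Lemma smooth_id U : smooth U (fun x : R => x).
Proof. by move=> k; apply: class_C_linear => // x; exact: cvg_id. Qed.

End OneVariable.

Section SmoothFunctions.
Context {R : realType} {V : normedModType R}.
Variables (U : set V).
Hypothesis oU : open U.
Implicit Types f g : V -> R.

Lemma smooth_comp_real (O : set R) (p : R -> R) f : open O -> smooth O p ->
  (forall x, U x -> O (f x)) -> smooth U f -> smooth U (fun x => p (f x)).
Proof.
move=> oO sp UO sf k.
exact: (class_C_comp (@coord_system_real R) oU oO UO (fun=> sf k) (sp k)).
Qed.

Lemma smooth_cst (c : R) : smooth U (fun=> c).
Proof. by move=> k; exact: class_C_cst. Qed.

Lemma smoothD f g : smooth U f -> smooth U g -> smooth U (fun x => f x + g x).
Proof. by move=> sf sg k; exact: class_CD. Qed.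

Lemma smoothM f g : smooth U f -> smooth U g -> smooth U (fun x => f x * g x).
Proof. by move=> sf sg k; exact: class_CM. Qed.

Lemma smoothN f : smooth U f -> smooth U (fun x => - f x).
Proof. by move=> sf k; exact: class_CN. Qed.

Lemma smoothB f g : smooth U f -> smooth U g -> smooth U (fun x => f x - g x).
Proof. by move=> sf sg; apply: smoothD => //; exact: smoothN. Qed.

Lemma smoothV f : (forall x, U x -> f x != 0) -> smooth U f ->
  smooth U (fun x => (f x)^-1).
Proof. exact: smooth_comp_real open_neq0 smooth_inv. Qed.

End SmoothFunctions.

Lemma smooth_atan {R : realType} : smooth setT (@atan R).
Proof.
have oT : open [set: R] by exact: openT.
case=> [|k]; first exact: (class_C0_derivable (fun x _ => is_derive1_atan x)).
apply: (class_C1 oT (fun x _ => is_derive1_atan x)); move: k.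
apply: (smoothV oT) => [x _|]; first by rewrite gt_eqF// ltr_pwDl// sqr_ge0.
apply: (smoothD oT); first exact: smooth_cst.
by apply: (smoothM oT); exact: smooth_id.
Qed.

Section ComplexSmooth.
Context {R : realType} {V : normedModType R}.
Variables (U : set V).
Hypothesis oU : open U.
Implicit Types f g : V -> R[i].

Definition csmooth f := smooth U (fun x => complex.Re (f x)) /\
  smooth U (fun x => complex.Im (f x)).

Lemma csmooth_cst (c : R[i]) : csmooth (fun=> c).
Proof. by split; exact: smooth_cst. Qed.

Lemma csmooth_real (f : V -> R) : smooth U f -> csmooth (fun x => (f x)%:C%C).
Proof. by move=> sf; split=> //; exact: smooth_cst. Qed.

Lemma csmoothD f g : csmooth f -> csmooth g -> csmooth (fun x => f x + g x).
Proof.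
move=> [f1 f2] [g1 g2]; split.
  rewrite (_ : (fun x => _) = fun x => complex.Re (f x) + complex.Re (g x)); first exact: smoothD.
  by apply/funext => x; case: (f x); case: (g x).
rewrite (_ : (fun x => _) = fun x => complex.Im (f x) + complex.Im (g x)); first exact: smoothD.
by apply/funext => x; case: (f x); case: (g x).
Qed.

Lemma csmoothM f g : csmooth f -> csmooth g -> csmooth (fun x => f x * g x).
Proof.
move=> [f1 f2] [g1 g2]; split.
  rewrite (_ : (fun x => _) = fun x => complex.Re (f x) * complex.Re (g x) -
     complex.Im (f x) * complex.Im (g x)); first by apply: smoothB => //; exact: smoothM.
  by apply/funext => x; case: (f x); case: (g x).
rewrite (_ : (fun x => _) = fun x => complex.Re (f x) * complex.Im (g x) +
     complex.Im (f x) * complex.Re (g x)); first by apply: smoothD => //; exact: smoothM.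
by apply/funext => x; case: (f x); case: (g x).
Qed.

Lemma csmoothN f : csmooth f -> csmooth (fun x => - f x).
Proof.
move=> sf; rewrite (_ : (fun x => _) = fun x => -1 * f x).
  by apply: csmoothM => //; exact: csmooth_cst.
by apply/funext => x; rewrite mulN1r.
Qed.

Lemma csmoothB f g : csmooth f -> csmooth g -> csmooth (fun x => f x - g x).
Proof. by move=> sf sg; apply: csmoothD => //; exact: csmoothN. Qed.

Lemma csmooth_conj f : csmooth f -> csmooth (fun x => (f x)^*).
Proof.
move=> [f1 f2]; split.
  rewrite (_ : (fun x => _) = fun x => complex.Re (f x)) //.
  by apply/funext => x; case: (f x).
rewrite (_ : (fun x => _) = fun x => - complex.Im (f x)); first exact: smoothN.
by apply/funext => x; case: (f x).
Qed.

Lemma csmoothV f : (forall x, U x -> f x != 0) -> csmooth f ->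
  csmooth (fun x => (f x)^-1).
Proof.
move=> f0 [f1 f2].
pose n x := complex.Re (f x) * complex.Re (f x) + complex.Im (f x) * complex.Im (f x).
have n0 x : U x -> n x != 0.
  move=> /f0; rewrite /n -!expr2 paddr_eq0 ?sqr_ge0// !sqrf_eq0.
  by rewrite eq_complex.
have sn : smooth U (fun x => (n x)^-1).
  by apply: smoothV => //; apply: smoothD => //; exact: smoothM.
split.
  rewrite (_ : (fun x => _) = fun x => complex.Re (f x) * (n x)^-1); first exact: smoothM.
  by apply/funext => x; rewrite /n -!expr2; case: (f x).
rewrite (_ : (fun x => _) = fun x => - (complex.Im (f x) * (n x)^-1)).
  by apply: smoothN => //; exact: smoothM.
by apply/funext => x; rewrite /n -!expr2; case: (f x).
Qed.

Lemma csmooth_sum (I : Type) (s : seq I) (P : pred I) (F : I -> V -> R[i]) :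
  (forall i, csmooth (F i)) -> csmooth (fun x => \sum_(i <- s | P i) F i x).
Proof.
move=> sF; elim: s => [|i s IH].
  rewrite (_ : (fun x => _) = fun=> 0); first exact: csmooth_cst.
  by apply/funext => x; rewrite big_nil.
rewrite (_ : (fun x => _) = fun x => (if P i then F i x else 0) + \sum_(i <- s | P i) F i x).
  by apply: csmoothD => //; case: (P i) => //; exact: csmooth_cst.
by apply/funext => x; rewrite big_cons; case: (P i); rewrite ?add0r.
Qed.

Lemma csmooth_prod (I : Type) (s : seq I) (P : pred I) (F : I -> V -> R[i]) :
  (forall i, csmooth (F i)) -> csmooth (fun x => \prod_(i <- s | P i) F i x).
Proof.
move=> sF; elim: s => [|i s IH].
  rewrite (_ : (fun x => _) = fun=> 1); first exact: csmooth_cst.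
  by apply/funext => x; rewrite big_nil.
rewrite (_ : (fun x => _) = fun x => (if P i then F i x else 1) * \prod_(i <- s | P i) F i x).
  by apply: csmoothM => //; case: (P i) => //; exact: csmooth_cst.
by apply/funext => x; rewrite big_cons; case: (P i); rewrite ?mul1r.
Qed.

Definition msmooth m n (F : V -> 'M[R[i]]_(m, n)) :=
  forall i j, csmooth (fun x => F x i j).

Lemma msmoothM m n p (F : V -> 'M[R[i]]_(m, n)) (G : V -> 'M[R[i]]_(n, p)) :
  msmooth F -> msmooth G -> msmooth (fun x => F x *m G x).
Proof.
move=> sF sG i j; rewrite (_ : (fun x => _) = (fun x => \sum_k F x i k * G x k j)).
  by apply: csmooth_sum => k; exact: csmoothM.
by apply/funext => x; rewrite mxE.
Qed.

Lemma msmoothD m n (F G : V -> 'M[R[i]]_(m, n)) :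
  msmooth F -> msmooth G -> msmooth (fun x => F x + G x).
Proof.
move=> sF sG i j; rewrite (_ : (fun x => _) = fun x => F x i j + G x i j).
  exact: csmoothD.
by apply/funext => x; rewrite mxE.
Qed.

Lemma msmoothZ m n (c : R[i]) (F : V -> 'M[R[i]]_(m, n)) :
  msmooth F -> msmooth (fun x => c *: F x).
Proof.
move=> sF i j; rewrite (_ : (fun x => _) = fun x => c * F x i j).
  by apply: csmoothM => //; exact: csmooth_cst.
by apply/funext => x; rewrite mxE.
Qed.

Lemma msmooth_cst m n (A : 'M[R[i]]_(m, n)) : msmooth (fun=> A).
Proof. by move=> i j; exact: csmooth_cst. Qed.

Lemma csmooth_det n (F : V -> 'M[R[i]]_n) : msmooth F -> csmooth (fun x => \det (F x)).
Proof.
move=> sF; apply: csmooth_sum => s; apply: csmoothM; first exact: csmooth_cst.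
exact: csmooth_prod.
Qed.

Lemma msmooth_adj n (F : V -> 'M[R[i]]_n) : msmooth F -> msmooth (fun x => \adj (F x)).
Proof.
move=> sF i j.
rewrite (_ : (fun x => _) = fun x => (-1) ^+ (j + i) * \det (row' j (col' i (F x)))).
  apply: csmoothM; first exact: csmooth_cst.
  apply: csmooth_det => k l.
  by rewrite (_ : (fun x => _) = fun x => F x (lift j k) (lift i l))//;
    apply/funext => x; rewrite !mxE.
by apply/funext => x; rewrite mxE.
Qed.

Lemma msmooth_mx3 (rows : V -> seq (seq R[i])) :
  (forall i j : 'I_3, csmooth (fun x => nth 0 (nth [::] (rows x) i) j)) ->
  msmooth (fun x => mx3 (rows x)).
Proof.
move=> sF i j; rewrite (_ : (fun x => _) = (fun x => nth 0 (nth [::] (rows x) i) j))//.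
by apply/funext => x; rewrite mxE.
Qed.

End ComplexSmooth.

(** * Matrix exponentials *)

Lemma mulmx3 (T : nzRingType) (a b c d e f g h k a' b' c' d' e' f' g' h' k' : T) :
  mx3 [:: [:: a; b; c]; [:: d; e; f]; [:: g; h; k]] *m
  mx3 [:: [:: a'; b'; c']; [:: d'; e'; f']; [:: g'; h'; k']] =
  mx3 [:: [:: a * a' + b * d' + c * g'; a * b' + b * e' + c * h'; a * c' + b * f' + c * k'];
          [:: d * a' + e * d' + f * g'; d * b' + e * e' + f * h'; d * c' + e * f' + f * k'];
          [:: g * a' + h * d' + k * g'; g * b' + h * e' + k * h'; g * c' + h * f' + k * k']].
Proof.
apply/matrixP => i j; rewrite !mxE !big_ord_recr big_ord0 /= !mxE /= add0r.
by case: i => -[|[|[|//]]] ?; case: j => -[|[|[|//]]] ?.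
Qed.

Ltac mx3_entries := apply/matrixP => -[[|[|[|//]]] ?] [[|[|[|//]]] ?].

Section Exponentials.
Context {R : realType}.

Lemma iE : 'i = 'i%C :> R[i]. Proof. by []. Qed.

(** The partial sums are stationary from the third one on. *)
Lemma expm_nilpotent (X : Mat R) : X ^+ 3 = 0 ->
  expm X = 1 + X + 2^-1 *: X ^+ 2.
Proof.
move=> X3; set E := RHS.
have SE n : (3 <= n)%N -> \sum_(k < n) (k`!%:R)^-1 *: X ^+ k = E.
  move=> n3; rewrite -(subnKC n3) big_split_ord /= [X in _ + X]big1 => [|k _].
    by rewrite !big_ord_recr big_ord0 /= add0r addr0 !invr1 !scale1r.
  by rewrite exprD X3 mul0r scaler0.
apply/matrixP => i j; rewrite mxE (_ : E i j = (complex.Re (E i j) +i* complex.Im (E i j))%C);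
  last by case: (E i j).
by congr Complex; apply: lim_near_cst => //; near=> n; rewrite SE//; near: n; exact: nbhs_infty_ge.
Unshelve. all: by end_near. Qed.

Definition hyp (c s : R[i]) : Mat R :=
  mx3 [:: [:: c; 0; s]; [:: 0; 1; 0]; [:: s; 0; c]].

Lemma expY_pow (t : R) k : ('i *: elt_Y t) ^+ k.+1 =
  mx3 [:: [:: (odd k)%:R * ('i * t%:C%C) ^+ k.+1; 0; (~~ odd k)%:R * ('i * t%:C%C) ^+ k.+1];
          [:: 0; 0; 0];
          [:: (~~ odd k)%:R * ('i * t%:C%C) ^+ k.+1; 0; (odd k)%:R * ('i * t%:C%C) ^+ k.+1]].
Proof.
have YE : 'i *: elt_Y t = mx3 [:: [:: 0; 0; 'i * t%:C%C]; [:: 0; 0; 0]; [:: 'i * t%:C%C; 0; 0]].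
  by mx3_entries; rewrite !mxE /= ?mulr0.
elim: k => [|k IH]; first by rewrite expr1 YE; mx3_entries; rewrite !mxE /= ?mul0r ?mul1r.
rewrite exprS IH YE [LHS]mulmx3.
by mx3_entries; rewrite !mxE /= ?mul0r ?add0r ?mulr0 ?addr0// mulrCA -exprS ?negbK.
Qed.

(** The parity of the exponent separates the real powers, which build the cosine
    series, from the imaginary ones, which build the sine series. *)
Lemma powi (t : R) k : ('i * t%:C%C) ^+ k =
  (if odd k then 0 +i* ((-1) ^+ k.-1./2 * t ^+ k) else ((-1) ^+ k./2 * t ^+ k) +i* 0)%C :> R[i].
Proof.
elim: k => [|k IH]; first by rewrite !expr0 mul1r.
rewrite exprS IH iE /= uphalf_half.
case: ifP => ok /=; rewrite ?ok /=; apply/eqP; rewrite eq_complex /=; apply/andP.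
  have -> : k./2 = k.-1./2 by case: (k) ok => //= k' /negbTE ok'; rewrite uphalf_half ok'.
  by rewrite add1n !exprS; split; apply/eqP; ring.
by rewrite exprS; split; apply/eqP; ring.
Qed.

(** The entries of the partial sums are exactly the partial sums of the series
    defining the cosine and the sine. *)
Lemma expm_Y (t : R) : expm ('i *: elt_Y t) = hyp (cos t)%:C%C ('i * (sin t)%:C%C).
Proof.
pose S n : Mat R := \sum_(k < n) (k`!%:R)^-1 *: ('i *: elt_Y t) ^+ k.
have factE k : (k`!%:R : R[i])^-1 = ((k`!%:R)^-1 : R)%:C%C.
  by rewrite -[in LHS](rmorph_nat (real_complex R)) -fmorphV.
have pw k i j : (('i *: elt_Y t) ^+ k) i j =
   (((~~ odd k)%:R * hyp 1 0 i j + (odd k)%:R * hyp 0 1 i j - (hyp 0 0 i j) *+ (k != 0%N)) *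
    ('i * t%:C%C) ^+ k).
  case: k => [|k].
    rewrite expr0 /=; case: i => -[|[|[|//]]] ?; case: j => -[|[|[|//]]] ?;
    by rewrite !mxE /=; ring.
  rewrite expY_pow; case: i => -[|[|[|//]]] ?; case: j => -[|[|[|//]]] ?;
    rewrite !mxE /=; case: (odd k) => /=; ring.
have SE n : S n = hyp (series (cos_coeff t) n)%:C%C ('i * (series (sin_coeff t) n)%:C%C)
   - (if n is 0%N then hyp 0 0 else 0).
  elim: n => [|n IH].
    by rewrite /S big_ord0 /series /= !big_geq// mulr0 subrr.
  rewrite /S big_ord_recr /= -/(S n) IH.
  rewrite /series /= !big_nat_recr//= cos_coeffE sin_coeffE.
  apply/matrixP => i j; rewrite !mxE pw factE powi iE.
  case: n {IH} => [|n].
    rewrite !big_geq//=; case: i => -[|[|[|//]]] ?; case: j => -[|[|[|//]]] ?;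
    by rewrite !mxE /=; apply/eqP; rewrite eq_complex /=; apply/andP; split; apply/eqP; rewrite ?invr1 /=; ring.
  case: i => -[|[|[|//]]] ?; case: j => -[|[|[|//]]] ?;
    rewrite !mxE /=; case: (odd n) => /=; apply/eqP; rewrite eq_complex /=; apply/andP; split; apply/eqP; ring.
have cc : series (cos_coeff t) @ \oo --> cos t.
  by rewrite unlock; exact: is_cvg_series_cos_coeff.
have cs : series (sin_coeff t) @ \oo --> sin t.
  by rewrite unlock; exact: is_cvg_series_sin_coeff.
have lim_eq (u v : R^nat) l : (forall n, u n.+1 = v n.+1) -> v @ \oo --> l -> limn u = l.
  move=> uv vl; apply: cvg_lim => //; apply: cvg_trans vl; apply: near_eq_cvg.
  by near=> n; rewrite -(prednK (_ : 0 < n)%N)// ?uv//; near: n; exact: nbhs_infty_gt.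
apply/matrixP => i j; rewrite mxE.
have hypE (x y : R) : hyp x%:C%C ('i * y%:C%C) =
    \matrix_(i, j) ((if i == j then if i == 1 then 1 else x else 0) +i*
      (if (i == j) || (i == 1) || (j == 1) then 0 else y))%C.
  by mx3_entries; rewrite !mxE /= ?iE//; apply/eqP; rewrite eq_complex /=; apply/andP; split; apply/eqP; ring.
rewrite hypE mxE; congr Complex.
  apply: (lim_eq _ (fun n => if i == j then if i == 1 then 1 else series (cos_coeff t) n else 0)) => [n|].
    by rewrite -/(S n.+1) SE subr0 hypE mxE.
  by case: (i == j); [case: (i == 1) => // |]; exact: cvg_cst.
apply: (lim_eq _ (fun n => if (i == j) || (i == 1) || (j == 1) then 0 else series (sin_coeff t) n)) => [n|].
  by rewrite -/(S n.+1) SE subr0 hypE mxE.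
by case: (_ || _) => //; exact: cvg_cst.
Unshelve. all: by end_near. Qed.

End Exponentials.

(** * Cosets as a column and a row *)

Section Cosets.
Context {R : realType}.
Local Notation C := R[i].
Implicit Types (m g h : Mat R).

Lemma I3_ind (P : 'I_3 -> Prop) : P 0 -> P 1 -> P ord_max -> forall i, P i.
Proof.
move=> P0 P1 P2 [[|[|[|//]]] i3].
- by rewrite (_ : Ordinal i3 = 0) //; exact: val_inj.
- by rewrite (_ : Ordinal i3 = 1) //; exact: val_inj.
- by rewrite (_ : Ordinal i3 = ord_max) //; exact: val_inj.
Qed.

Lemma sum3 (F : 'I_3 -> C) : \sum_i F i = F 0 + F 1 + F ord_max.
Proof.
rewrite !big_ord_recr big_ord0 /= add0r.
by congr (F _ + F _ + F _); exact: val_inj.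
Qed.

(** [vec m] and [cov m] stand for the third column of [m] and, when [m] has
    determinant 1, for the third row of its inverse; the adjugate is polynomial
    in the entries, hence smooth. *)
Definition vec (m : Mat R) : 'cV[C]_3 := col ord_max m.
Definition cov (m : Mat R) : 'rV[C]_3 := row ord_max (\adj m).
Definition e3 : 'cV[C]_3 := @delta_mx C 3 1 ord_max ord0.
Definition f3 : 'rV[C]_3 := @delta_mx C 1 3 ord0 ord_max.

Lemma vecM m (m' : Mat R) : vec (m *m m') = m *m vec m'.
Proof. by rewrite /vec !colE mulmxA. Qed.

Lemma vecE m : vec m = m *m e3.
Proof. by rewrite /vec colE. Qed.

Lemma adj_mul m : \det m = 1 -> \adj m *m m = 1%:M :> Mat R.
Proof. by move=> d; rewrite mul_adj_mx d. Qed.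

Lemma mul_adj m : \det m = 1 -> m *m \adj m = 1%:M.
Proof. by move=> d; rewrite mul_mx_adj d. Qed.

Lemma covE m : cov m = f3 *m \adj m.
Proof. by rewrite /cov rowE. Qed.

Lemma cov_mul m : \det m = 1 -> cov m *m m = f3.
Proof. by move=> d; rewrite covE -mulmxA adj_mul// mulmx1. Qed.

Lemma cov_uniq m w : \det m = 1 -> w *m m = f3 -> w = cov m.
Proof. by move=> d wm; rewrite -[w]mulmx1 -(mul_adj d) mulmxA wm covE. Qed.

Lemma cov_vec m : \det m = 1 -> cov m *m vec m = 1%:M.
Proof.
move=> d; rewrite vecE mulmxA cov_mul//.
by apply/matrixP => i j; rewrite !ord1 mxE sum3 !mxE /= !mul0r !add0r mul1r.
Qed.

Lemma KCP (g : Mat R) : KC R g <-> \det g = 1 /\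
  forall i : 'I_3, i != ord_max -> g i ord_max = 0 /\ g ord_max i = 0.
Proof.
split.
  move=> [h [z [_ _ gE dg]]]; split=> // i i2.
  have [k ->] : exists k : 'I_2, i = lshift 1 k.
    have i2' : (i < 2)%N by rewrite ltn_neqAle -ltnS ltn_ord andbT.
    by exists (Ordinal i2'); exact: val_inj.
  have -> : ord_max = rshift 2 (ord0 : 'I_1) :> 'I_3 by exact: val_inj.
  by rewrite gE; split; [rewrite [LHS](@block_mxEur _ 2 1 2 1) | rewrite [LHS](@block_mxEdl _ 2 1 2 1)]; rewrite mxE.
move=> [dg g0].
pose h := @ulsubmx _ 2 1 2 1 g; pose z := @drsubmx _ 2 1 2 1 g.
have ur : @ursubmx _ 2 1 2 1 g = 0.
  apply/matrixP => i j; rewrite !mxE.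
  have -> : @rshift 2 1 j = ord_max by apply: val_inj; rewrite /= ord1.
  by apply: (g0 _ _).1; rewrite -val_eqE /= ltn_eqF.
have dl : @dlsubmx _ 2 1 2 1 g = 0.
  apply/matrixP => i j; rewrite !mxE.
  have -> : @rshift 2 1 i = ord_max by apply: val_inj; rewrite /= ord1.
  by apply: (g0 _ _).2; rewrite -val_eqE /= ltn_eqF.
have gE : g = block_mx h 0 0 z by rewrite -[LHS](@submxK _ 2 1 2 1) ur dl.
exists h, z.
have := dg; rewrite {1}gE (@det_ublock _ 2 1) => d.
have : \det h * \det z \is a GRing.unit by rewrite d unitr1.
by rewrite unitrM !unitmxE => /andP[-> ->].
Qed.

(** The stabilizer of the base point consists of the matrices that preserve both
    the line of the third basis vector and the plane of the first two, that is
    the kernel of the third coordinate form. *)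
Lemma cosetP (m m' : Mat R) : \det m = 1 -> \det m' = 1 ->
  act m (base_point R) = act m' (base_point R) <->
  exists2 z : C, z != 0 & vec m' = z *: vec m /\ cov m' = z^-1 *: cov m.
Proof.
move=> d d'.
have KCvec h : KC R h -> exists2 z : C, z != 0 & vec h = z *: e3 /\ f3 *m h = z *: f3.
  move=> /KCP[dh h0]; exists (h ord_max ord_max).
    apply/eqP => hz; have : \det h = 0.
      rewrite (expand_det_col _ ord_max) big1// => i _.
      have [->|i2] := eqVneq i ord_max; first by rewrite hz mul0r.
      by rewrite (h0 i i2).1 mul0r.
    by rewrite dh => /eqP; rewrite oner_eq0.
  split; apply/matrixP => i j.
    rewrite !ord1 !mxE; have [->|i2] := eqVneq i ord_max; first by rewrite mulr1.
    by rewrite mulr0 (h0 i i2).1.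
  rewrite -rowE !ord1 !mxE; have [->|j2] := eqVneq j ord_max; first by rewrite mulr1.
  by rewrite mulr0 (h0 j j2).2.
split=> [E|].
  have : act m' (base_point R) m'.
    exists 1%:M; last by rewrite mulmx1.
    apply/KCP; split=> [|i i2]; first exact: det1.
    by rewrite !mxE [ord_max == i]eq_sym (negbTE i2).
  rewrite -E => -[h /KCvec[z z0 [hv hf]] hm].
  exists z => //; split; first by rewrite -hm vecM hv -scalemxAr -vecE.
  apply/esym/(cov_uniq d').
  by rewrite -hm -scalemxAl mulmxA cov_mul// hf scalerA mulVf// scale1r.
suff inc m1 m2 (z : C) : \det m1 = 1 -> \det m2 = 1 -> z != 0 ->
    vec m2 = z *: vec m1 -> cov m2 = z^-1 *: cov m1 ->
    act m2 (base_point R) `<=` act m1 (base_point R).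
  case=> z z0 [ev ec]; apply/seteqP; split; last exact: (inc m m' z d d' z0 ev ec).
  apply: (inc m' m z^-1 d' d); first by rewrite invr_eq0.
    by rewrite ev scalerA mulVf// scale1r.
  by rewrite ec invrK scalerA mulfV// scale1r.
move=> d1 d2 z0 ev ec _ [k /KCP[dk k0] <-].
pose h := \adj m1 *m m2.
have da : \det (\adj m1) = 1.
  by have := congr1 determinant (adj_mul d1); rewrite det_mulmx d1 mulr1 det1.
have hv : vec h = z *: e3 by rewrite /h vecM ev -scalemxAr vecE mulmxA adj_mul// mul1mx.
have hf : f3 *m h = z *: f3.
  have -> : f3 *m h = (z *: cov m2) *m m2 by rewrite ec scalerA mulfV// scale1r covE /h mulmxA.
  by rewrite -scalemxAl cov_mul.
have hK : KC R h.
  apply/KCP; split=> [|i i2]; first by rewrite det_mulmx da d2 mulr1.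
  split; first by have := congr1 (fun v : 'cV_3 => v i 0) hv; rewrite !mxE (negbTE i2) mulr0.
  have := congr1 (fun v : 'rV_3 => v 0 i) hf; rewrite -rowE !mxE (negbTE i2) mulr0; exact.
move/KCP : hK => [dh h0].
exists (h *m k).
  apply/KCP; split=> [|i i2]; first by rewrite det_mulmx dh dk mulr1.
  rewrite !mxE; split; rewrite big1// => j _.
    have [->|j2] := eqVneq j ord_max; first by rewrite (h0 i i2).1 mul0r.
    by rewrite (k0 j j2).1 mulr0.
  have [->|j2] := eqVneq j ord_max; first by rewrite (k0 i i2).2 mulr0.
  by rewrite (h0 j j2).2 mul0r.
by rewrite /h !mulmxA mul_adj// mul1mx.
Qed.

End Cosets.

(** * Siegel coordinates *)

Section Siegel.
Context {R : realType}.
Local Notation C := R[i].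
Implicit Types (v : 'cV[C]_3) (w : 'rV[C]_3) (m g : Mat R).

(** The coordinates of a column in a basis adapted to the null vector (1,0,1) fixed
    by [N]; [rP], [rS], [rQ] are the dual coordinates of a row. *)
Definition cp v := v 0 0 + v ord_max 0.
Definition cs v := v 1 0.
Definition cq v := v ord_max 0 - v 0 0.
Definition rP w := w 0 ord_max - w 0 0.
Definition rS w := - w 0 1.
Definition rQ w := w 0 0 + w 0 ord_max.

Lemma siegel_pairing w v :
  (w *m v) 0 0 = (cp v * rQ w + cq v * rP w) / 2 - cs v * rS w.
Proof. by rewrite mxE sum3 /cp /cs /cq /rP /rS /rQ; field. Qed.

Lemma siegel_vec_inj v v' : cp v = cp v' -> cs v = cs v' -> cq v = cq v' -> v = v'.
Proof.
move=> ep es eq; apply/matrixP => i j; rewrite ord1; elim/I3_ind: i => //.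
  have E (u : 'cV[C]_3) : u 0 0 = (cp u - cq u) / 2 by rewrite /cp /cq; field.
  by rewrite E (E v') ep eq.
have E (u : 'cV[C]_3) : u ord_max 0 = (cp u + cq u) / 2 by rewrite /cp /cq; field.
by rewrite E (E v') ep eq.
Qed.

Lemma siegel_cov_inj w w' : rP w = rP w' -> rS w = rS w' -> rQ w = rQ w' -> w = w'.
Proof.
move=> ep es eq; apply/matrixP => i j; rewrite ord1; elim/I3_ind: j.
- have E (u : 'rV[C]_3) : u 0 0 = (rQ u - rP u) / 2 by rewrite /rP /rQ; field.
  by rewrite E (E w') ep eq.
- by move: es => /oppr_inj.
have E (u : 'rV[C]_3) : u 0 ord_max = (rP u + rQ u) / 2 by rewrite /rP /rQ; field.
by rewrite E (E w') ep eq.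
Qed.

Lemma siegelZ z v : (cp (z *: v) = z * cp v) * (cs (z *: v) = z * cs v) *
  (cq (z *: v) = z * cq v).
Proof. by do !split; rewrite /cp /cs /cq !mxE; ring. Qed.

Lemma siegelZr z w : (rP (z *: w) = z * rP w) * (rS (z *: w) = z * rS w) *
  (rQ (z *: w) = z * rQ w).
Proof. by do !split; rewrite /rP /rS /rQ !mxE; ring. Qed.

(** The exponential of a complexified element of the Lie algebra of [N]; the
    entry [h] absorbs the central parameter and the quadratic term of the
    exponential. *)
Definition unip (x y h : C) : Mat R :=
  mx3 [:: [:: 1 + h; x; - h]; [:: - y; 1; y]; [:: h; x; 1 - h]].

Lemma siegel_unip x y h v :
  (cp (unip x y h *m v) = cp v + 2 * x * cs v - 2 * h * cq v) *
  (cs (unip x y h *m v) = cs v + y * cq v) *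
  (cq (unip x y h *m v) = cq v).
Proof.
rewrite /cp /cs /cq; do !split; rewrite !mxE !sum3 !mxE /=; ring.
Qed.

Lemma siegel_unip_row x y h w :
  (rP (w *m unip x y h) = rP w - 2 * h * rQ w - 2 * y * rS w) *
  (rS (w *m unip x y h) = rS w - x * rQ w) *
  (rQ (w *m unip x y h) = rQ w).
Proof.
rewrite /rP /rS /rQ; do !split; rewrite !mxE !sum3 !mxE /=; ring.
Qed.

Lemma siegel_hyp c s v :
  (cp (hyp c s *m v) = (c + s) * cp v) *
  (cs (hyp c s *m v) = cs v) *
  (cq (hyp c s *m v) = (c - s) * cq v).
Proof.
rewrite /cp /cs /cq; do !split; rewrite !mxE !sum3 !mxE /=; ring.
Qed.

Lemma siegel_hyp_row c s w :
  (rP (w *m hyp c s) = (c - s) * rP w) *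
  (rS (w *m hyp c s) = rS w) *
  (rQ (w *m hyp c s) = (c + s) * rQ w).
Proof.
rewrite /rP /rS /rQ; do !split; rewrite !mxE !sum3 !mxE /=; ring.
Qed.

Lemma siegel_e3 : (cp e3 = 1 :> C) * (cs e3 = 0 :> C) * (cq e3 = 1 :> C).
Proof. by rewrite /cp /cs /cq !mxE /= subr0 add0r. Qed.

Lemma siegel_f3 : (rP f3 = 1 :> C) * (rS f3 = 0 :> C) * (rQ f3 = 1 :> C).
Proof. by rewrite /rP /rS /rQ !mxE /= subr0 add0r oppr0. Qed.

Lemma unipM x y h x' y' h' :
  unip x y h *m unip x' y' h' = unip (x + x') (y + y') (h + h' - x * y').
Proof.
rewrite [LHS]mulmx3; congr mx3.
by do ![congr (_ :: _)]; ring.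
Qed.

Lemma hypM c s c' s' : hyp c s *m hyp c' s' = hyp (c * c' + s * s') (c * s' + s * c') :> Mat R.
Proof. by rewrite [LHS]mulmx3; congr mx3; do ![congr (_ :: _)]; ring. Qed.

Lemma unip0 : unip 0 0 0 = 1%:M.
Proof. by mx3_entries; rewrite !mxE /= ?addr0 ?subr0 ?oppr0. Qed.

Lemma hyp1 : hyp 1 0 = 1%:M :> Mat R.
Proof. by mx3_entries; rewrite !mxE /=. Qed.

Lemma det_mx2 (A : 'M[C]_2) : \det A = A 0 0 * A 1 1 - A 0 1 * A 1 0.
Proof.
have e1 : lift 0 0 = 1 :> 'I_2 by exact: val_inj.
have e2 : lift 1 0 = 0 :> 'I_2 by exact: val_inj.
rewrite (expand_det_row _ 0) big_ord_recl big_ord1 /cofactor !det_mx11 !mxE e1 e2.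
by rewrite expr0 expr1; ring.
Qed.

Lemma det_mx3 (a b c d e f g h k : C) :
  \det (mx3 [:: [:: a; b; c]; [:: d; e; f]; [:: g; h; k]]) =
  a * (e * k - f * h) - b * (d * k - f * g) + c * (d * h - e * g).
Proof.
by rewrite (expand_det_row _ 0) sum3 /cofactor !det_mx2 !mxE /=; ring.
Qed.

End Siegel.

(** * The Hermitian form *)

Section Hermitian.
Context {R : realType}.
Local Notation C := R[i].
Implicit Types (v : 'cV[C]_3) (w : 'rV[C]_3) (m g : Mat R).

(** Minus the Hermitian form, so that it is positive on negative vectors; the
    formula is the defining function of the Siegel domain. *)
Definition herm v : R := complex.Re (cp v * (cq v)^* - cs v * (cs v)^*).
Definition hermr w : R := complex.Re (rP w * (rQ w)^* - rS w * (rS w)^*).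

Lemma hermE v : herm v =
  - complex.Re (((map_mx Num.conj v)^T *m form_mx R *m v) 0 0).
Proof.
rewrite /herm /cp /cs /cq !(mxE, sum3) /=.
by case: (v 0 0) => a b; case: (v 1 0) => c d; case: (v ord_max 0) => e f /=; ring.
Qed.

Lemma hermrE w : hermr w =
  - complex.Re ((w *m form_mx R *m (map_mx Num.conj w)^T) 0 0).
Proof.
rewrite /hermr /rP /rS /rQ !(mxE, sum3) /=.
by case: (w 0 0) => a b; case: (w 0 1) => c d; case: (w 0 ord_max) => e f /=; ring.
Qed.

Lemma map_conjM (m n p : nat) (A : 'M[C]_(m, n)) (B : 'M[C]_(n, p)) :
  (map_mx Num.conj (A *m B))^T = (map_mx Num.conj B)^T *m (map_mx Num.conj A)^T.
Proof. by rewrite map_mxM trmx_mul. Qed.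

Lemma form_sq : form_mx R *m form_mx R = 1%:M.
Proof. by rewrite [LHS]mulmx3; mx3_entries; rewrite !mxE /=; ring. Qed.

Lemma SU21_adj g : SU21 R g -> \adj g = form_mx R *m (map_mx Num.conj g)^T *m form_mx R.
Proof.
move=> [gJ dg].
have E : (form_mx R *m (map_mx Num.conj g)^T *m form_mx R) *m g = 1%:M.
  by rewrite -!mulmxA (mulmxA _ (form_mx R) g) gJ form_sq.
by rewrite -[LHS]mul1mx -E -(mulmxA _ g) mul_adj// mulmx1.
Qed.

Lemma SU21M g g' : SU21 R g -> SU21 R g' -> SU21 R (g *m g').
Proof.
move=> [gJ dg] [gJ' dg']; split; last by rewrite det_mulmx dg dg' mulr1.
rewrite map_conjM.
transitivity ((map_mx Num.conj g')^T *m
  ((map_mx Num.conj g)^T *m form_mx R *m g) *m g'); first by rewrite !mulmxA.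
by rewrite gJ gJ'.
Qed.

Lemma herm_SU21 g v : SU21 R g -> herm (g *m v) = herm v.
Proof.
move=> [gJ _]; rewrite !hermE map_conjM; congr (- complex.Re (_ 0 0)).
transitivity ((map_mx Num.conj v)^T *m
  ((map_mx Num.conj g)^T *m form_mx R *m g) *m v); first by rewrite !mulmxA.
by rewrite gJ.
Qed.

Lemma hermr_SU21 g w : SU21 R g -> hermr (w *m \adj g) = hermr w.
Proof.
move=> Gg; have [gJ _] := Gg; rewrite !hermrE map_conjM; congr (- complex.Re (_ 0 0)).
suff E : \adj g *m form_mx R *m (map_mx Num.conj (\adj g))^T = form_mx R.
  transitivity (w *m (\adj g *m form_mx R *m (map_mx Num.conj (\adj g))^T) *m
    (map_mx Num.conj w)^T); first by rewrite !mulmxA.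
  by rewrite E.
have JT : (map_mx Num.conj (form_mx R))^T = form_mx R.
  by mx3_entries; rewrite !mxE /= ?rmorph0 ?rmorph1 ?rmorphN1.
rewrite (SU21_adj Gg) !map_conjM JT.
have -> : (map_mx Num.conj ((map_mx Num.conj g)^T))^T = g.
  by apply/matrixP => i j; rewrite !mxE conjCK.
transitivity (form_mx R *m ((map_mx Num.conj g)^T *m
  ((form_mx R *m form_mx R) *m form_mx R) *m g) *m form_mx R); first by rewrite !mulmxA.
by rewrite form_sq mul1mx gJ form_sq mul1mx.
Qed.

Lemma cov_mulmx g m : \det g = 1 -> \det m = 1 -> cov (g *m m) = cov m *m \adj g.
Proof.
move=> dg dm; apply/esym/cov_uniq; first by rewrite det_mulmx dg dm mulr1.
by rewrite -mulmxA (mulmxA _ g) adj_mul// mul1mx cov_mul.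
Qed.

Lemma normJE (z : C) : z * z^* = (complex.Re z ^+ 2 + complex.Im z ^+ 2)%:C%C.
Proof.
case: z => x y; apply/eqP; rewrite eq_complex /=; apply/andP; split; apply/eqP; ring.
Qed.

Lemma ReMreal (x : R) (z : C) : complex.Re (x%:C%C * z) = x * complex.Re z.
Proof. by case: z => a b /=; ring. Qed.

Lemma hermZ z v : herm (z *: v) = (complex.Re z ^+ 2 + complex.Im z ^+ 2) * herm v.
Proof.
rewrite -ReMreal -normJE /herm !siegelZ !rmorphM; congr complex.Re; ring.
Qed.

Lemma hermrZ z w : hermr (z *: w) = (complex.Re z ^+ 2 + complex.Im z ^+ 2) * hermr w.
Proof.
rewrite -ReMreal -normJE /hermr !siegelZr !rmorphM; congr complex.Re; ring.
Qed.

Lemma norm2_gt0 (z : C) : z != 0 -> 0 < complex.Re z ^+ 2 + complex.Im z ^+ 2.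
Proof.
by rewrite eq_complex -sqrf_eq0 -[X in _ && X]sqrf_eq0 -paddr_eq0 ?sqr_ge0// lt0r addr_ge0 ?sqr_ge0 // andbT.
Qed.

Lemma Re_gt0_neq0 (z : C) : 0 < complex.Re z -> z != 0.
Proof. by move=> z0; apply: contraTneq z0 => ->; rewrite ltxx. Qed.

(** After multiplication by the conjugate of [q Q], the normalization [w v = 1]
    expresses twice the real part of [q Q] as a sum of the two positive
    quantities [herm v |Q|^2], [hermr w |q|^2] and of a square. *)
Lemma siegel_half_plane v w : (w *m v) 0 0 = 1 -> 0 < herm v -> 0 < hermr w ->
  0 < complex.Re (cq v * rQ w).
Proof.
move=> E; have {E} : cp v * rQ w + cq v * rP w - 2 * cs v * rS w = 2.
  apply: etrans (_ : 2 * (w *m v) 0 0 = _); last by rewrite E mulr1.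
  by rewrite siegel_pairing; field.
rewrite /herm /hermr.
case: (cp v) => p p'; case: (cs v) => s s'; case: (cq v) => q q'.
case: (rP w) => P P'; case: (rS w) => S S'; case: (rQ w) => Q Q'.
move=> /eqP; rewrite eq_complex /= => /andP[/eqP E1 /eqP E2] hv hw.
have q0 : 0 < q ^+ 2 + q' ^+ 2.
  rewrite lt0r addr_ge0 ?sqr_ge0 // andbT; apply: contraTneq hv => /eqP.
  rewrite paddr_eq0 ?sqr_ge0// !sqrf_eq0 => /andP[/eqP -> /eqP ->].
  by rewrite -leNgt; nra.
have Q0 : 0 < Q ^+ 2 + Q' ^+ 2.
  rewrite lt0r addr_ge0 ?sqr_ge0 // andbT; apply: contraTneq hw => /eqP.
  rewrite paddr_eq0 ?sqr_ge0// !sqrf_eq0 => /andP[/eqP -> /eqP ->].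
  by rewrite -leNgt; nra.
have A := mulr_gt0 hv Q0; have B := mulr_gt0 hw q0.
have zw : 0 <= (s * Q + s' * Q' - (S * q + S' * q')) ^+ 2 +
    (s' * Q - s * Q' + (S' * q - S * q')) ^+ 2 by rewrite addr_ge0 ?sqr_ge0.
have F1 := congr1 (fun z => z * (q * Q - q' * Q')) E1.
have F2 := congr1 (fun z => z * (q * Q' + q' * Q)) E2.
move: A B zw F1 F2 => /=; rewrite !expr2; lra.
Qed.

End Hermitian.

(** * The groups N and A *)

Section NA.
Context {R : realType}.
Local Notation C := R[i].
Implicit Types (v : 'cV[C]_3) (w : 'rV[C]_3) (m g : Mat R).

Lemma expm_nil (x y z : C) :
  expm (mx3 [:: [:: z; x; - z]; [:: - y; 0; y]; [:: z; x; - z]]) =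
  unip x y (z - x * y / 2).
Proof.
have X2 (X := mx3 [:: [:: z; x; - z]; [:: - y; 0; y]; [:: z; x; - z]]) :
    X ^+ 2 = mx3 [:: [:: - (x * y); 0; x * y]; [:: 0; 0; 0]; [:: - (x * y); 0; x * y]].
  by rewrite expr2 [LHS]mulmx3; congr mx3; do ![congr (_ :: _)]; ring.
rewrite expm_nilpotent.
  by rewrite X2; mx3_entries; rewrite !mxE /=; field.
rewrite exprS X2 [LHS]mulmx3.
by mx3_entries; rewrite !mxE /=; ring.
Qed.

Definition unipN (a : C) (b : R) := unip a a^* ('i * b%:C%C - a * a^* / 2).

Lemma expm_Z (a : C) (b : R) : expm (elt_Z a b) = unipN a b.
Proof. exact: expm_nil. Qed.

Lemma expm_iZ (a : C) (b : R) :
  expm ('i *: elt_Z a b) = unip ('i * a) ('i * a^*) (- b%:C%C + a * a^* / 2).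
Proof.
have i2 : 'i * 'i = -1 :> C by rewrite -expr2 sqrCi.
rewrite (_ : 'i *: _ = mx3 [:: [:: - b%:C%C; 'i * a; - - b%:C%C];
   [:: - ('i * a^*); 0; 'i * a^*]; [:: - b%:C%C; 'i * a; - - b%:C%C]]).
  by rewrite expm_nil; congr unip; rewrite mulrACA i2; ring.
mx3_entries; rewrite !mxE /= ?mulr0 ?mulrN// mulrA i2; ring.
Qed.

Lemma det_unip (x y h : C) : \det (unip x y h) = 1.
Proof. by rewrite det_mx3; ring. Qed.

Lemma det_hyp (c s : C) : \det (hyp c s) = c ^+ 2 - s ^+ 2.
Proof. by rewrite det_mx3; ring. Qed.

Lemma conj_mx3T (a b c d e f g h k : C) :
  (map_mx Num.conj (mx3 [:: [:: a; b; c]; [:: d; e; f]; [:: g; h; k]]))^T =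
  mx3 [:: [:: a^*; d^*; g^*]; [:: b^*; e^*; h^*]; [:: c^*; f^*; k^*]].
Proof. by mx3_entries; rewrite !mxE. Qed.

Lemma conjR (x : R) : (x%:C%C)^* = x%:C%C :> C.
Proof. by apply/eqP; rewrite eq_complex /= oppr0 !eqxx. Qed.

Lemma SU21_unipN (a : C) (b : R) : SU21 R (unipN a b).
Proof.
split; last exact: det_unip.
set h := 'i * b%:C%C - a * a^* / 2.
have hs : h^* = - h - a * a^*.
  rewrite /h rmorphB !rmorphM /= conjCi conjR conjCK fmorphV rmorph_nat.
  by field.
rewrite /unipN /unip -/h; move: h hs => h hs.
rewrite conj_mx3T !rmorphD !rmorphN !rmorph1 /= conjCK hs.
rewrite [X in X *m _]mulmx3 [LHS]mulmx3.
by congr mx3; do ![congr (_ :: _)]; ring.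
Qed.

Lemma elt_aE t : elt_a t = hyp ((expR t + expR (- t)) / 2)%:C%C
   ((expR t - expR (- t)) / 2)%:C%C :> Mat R.
Proof. by []. Qed.

Lemma boost_sum t : ((expR t + expR (- t)) / 2)%:C%C +
   ((expR t - expR (- t)) / 2)%:C%C = (expR t)%:C%C :> C.
Proof. by rewrite -rmorphD /=; congr (_ %:C)%C; field. Qed.

Lemma boost_diff t : ((expR t + expR (- t)) / 2)%:C%C -
   ((expR t - expR (- t)) / 2)%:C%C = (expR (- t))%:C%C :> C.
Proof. by rewrite -rmorphB /=; congr (_ %:C)%C; field. Qed.

Lemma det_elt_a t : \det (elt_a t : Mat R) = 1.
Proof.
by rewrite elt_aE det_hyp subr_sqr boost_sum boost_diff -rmorphM -expRD addNr expR0.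
Qed.

Lemma SU21_elt_a t : SU21 R (elt_a t).
Proof.
split; last exact: det_elt_a.
have := det_elt_a t; rewrite elt_aE det_hyp.
set c := (X in X ^+ 2 - _); set s := (X in _ - X ^+ 2) => cs1.
rewrite conj_mx3T !conjR rmorph0 rmorph1 [X in X *m _]mulmx3 [LHS]mulmx3 -/c -/s.
move: c s cs1 => c s cs1.
congr mx3; do ![congr (_ :: _)];
  first [ring | rewrite -[RHS]cs1; ring | rewrite -[in RHS]cs1; ring].
Qed.

Lemma siegel_elt_a t v :
  (cp (elt_a t *m v) = (expR t)%:C%C * cp v) * (cs (elt_a t *m v) = cs v) *
  (cq (elt_a t *m v) = (expR (- t))%:C%C * cq v).
Proof. by rewrite elt_aE !siegel_hyp boost_sum boost_diff. Qed.

(** The translations of [N] bring a point of the Siegel domain to one with [s = 0]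
    and [p/q] real, and the dilations of [A] then bring it to the base point. *)
Lemma NA_transitive v : 0 < herm v ->
  exists a b t z, v = z *: (unipN a b *m elt_a t *m e3).
Proof.
move=> hv; have q0 : cq v != 0.
  apply: contraTneq hv => q0; rewrite /herm q0 rmorph0 mulr0 sub0r normJE /= -leNgt oppr_le0.
  by rewrite addr_ge0// sqr_ge0.
have n0 := norm2_gt0 q0.
pose d := herm v / (complex.Re (cq v) ^+ 2 + complex.Im (cq v) ^+ 2).
have d0 : 0 < d by exact: divr_gt0.
pose t := ln d / 2; have tE : expR t * expR t = d.
  by rewrite -expRD -mulr2n -mulr_natr divfK ?lnK.
have tV : expR t * expR (- t) = 1 by rewrite -expRD subrr expR0.
exists ((cs v / cq v)^*), (- complex.Im (cp v / cq v) / 2), t, (cq v * (expR t)%:C%C).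
apply: siegel_vec_inj; rewrite siegelZ -mulmxA !siegel_unip !siegel_elt_a !siegel_e3.
- set b := - _ / 2.
  have -> : cp v = cq v * (d%:C%C + (cs v / cq v) * (cs v / cq v)^* - 2 * ('i * b%:C%C)).
    rewrite -[LHS](divfK q0) mulrC; congr (_ * _).
    rewrite normJE.
    have -> : d = complex.Re (cp v / cq v) - (complex.Re (cs v / cq v) ^+ 2 + complex.Im (cs v / cq v) ^+ 2).
      rewrite /d /herm; move: q0 n0.
      case: (cp v) => p p'; case: (cs v) => s s'; case: (cq v) => q q' /= _ n0.
      by field; rewrite gt_eqF.
    by apply/eqP; rewrite eq_complex /= /b; apply/andP; split; apply/eqP; field.
  rewrite conjCK -tE (rmorphM (real_complex R)) /= -[RHS]mulrA; congr (_ * _).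
  have tV' : (expR t)%:C%C * (expR (- t))%:C%C = 1 :> C by rewrite -rmorphM tV.
  set A := (cs v / cq v); set B := A^*.
  transitivity ((expR t)%:C%C * (expR t)%:C%C + ((expR t)%:C%C * (expR (- t))%:C%C) * (A * B - 2 * ('i * b%:C%C))).
    by rewrite tV'; ring.
  by field.
- rewrite conjCK add0r mulr1 [RHS](_ : _ = (cs v / cq v) * cq v * ((expR t)%:C%C * (expR (- t))%:C%C)); last by ring.
  by rewrite -rmorphM tV mulr1 divfK.
by rewrite mulr1 -mulrA -rmorphM tV mulr1.
Qed.

End NA.

(** * The crown in terms of negative lines *)

Section Crown.
Context {R : realType}.
Local Notation C := R[i].
Implicit Types (v : 'cV[C]_3) (w : 'rV[C]_3) (m g : Mat R).

(** The row that represents minus the Hermitian product with [v]; it is how a row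
    is compared with a column. *)
Definition hdual v : 'rV[C]_3 := - ((map_mx Num.conj v)^T *m form_mx R).
Definition hundual w : 'cV[C]_3 := - (form_mx R *m (map_mx Num.conj w)^T).
Definition hpair v v' : C := (hdual v *m v') 0 0.

Lemma hpairE v v' : hpair v v' =
  (v ord_max 0)^* * v' ord_max 0 - (v 0 0)^* * v' 0 0 - (v 1 0)^* * v' 1 0.
Proof. by rewrite /hpair /hdual !(mxE, sum3) /=; ring. Qed.

Lemma hdualK w : hdual (hundual w) = w.
Proof.
apply/matrixP => i j; rewrite ord1; rewrite /hdual /hundual !(mxE, sum3).
elim/I3_ind: j; rewrite /= !(rmorphN, rmorphD, rmorphM, rmorph0, rmorph1) /= !conjCK; ring.
Qed.

Lemma hdual_mul g v : SU21 R g -> hdual (g *m v) *m g = hdual v.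
Proof.
by move=> [gJ _]; rewrite /hdual map_conjM !mulNmx -!mulmxA (mulmxA _ _ g) gJ.
Qed.

Lemma hdualD v v' : hdual (v + v') = hdual v + hdual v'.
Proof. by rewrite /hdual map_mxD linearD mulmxDl opprD. Qed.

Lemma hdualZ z v : hdual (z *: v) = z^* *: hdual v.
Proof. by rewrite /hdual map_mxZ linearZ /= -scalemxAl scalerN. Qed.

Lemma hpair_SU21 g v v' : SU21 R g -> hpair (g *m v) (g *m v') = hpair v v'.
Proof. by move=> Gg; rewrite /hpair mulmxA hdual_mul. Qed.

Lemma hpairDl v v' u : hpair (v + v') u = hpair v u + hpair v' u.
Proof. by rewrite /hpair hdualD mulmxDl mxE. Qed.
Lemma hpairDr v v' u : hpair u (v + v') = hpair u v + hpair u v'.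
Proof. by rewrite /hpair mulmxDr mxE. Qed.
Lemma hpairZl z v u : hpair (z *: v) u = z^* * hpair v u.
Proof. by rewrite /hpair hdualZ -scalemxAl mxE. Qed.
Lemma hpairZr z v u : hpair u (z *: v) = z * hpair u v.
Proof. by rewrite /hpair -scalemxAr mxE. Qed.
Lemma hpair_conj v u : (hpair v u)^* = hpair u v.
Proof. by rewrite !hpairE !rmorphB !rmorphM /= !conjCK ![_^* * _]mulrC. Qed.

Lemma hpair_herm v : hpair v v = (herm v)%:C%C.
Proof.
rewrite hpairE /herm /cp /cs /cq.
case: (v 0 0) => a b; case: (v 1 0) => c d; case: (v ord_max 0) => e f.
by apply/eqP; rewrite eq_complex /=; apply/andP; split; apply/eqP; ring.
Qed.

Lemma herm_hundual w : herm (hundual w) = hermr w.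
Proof.
rewrite /herm /hermr /cp /cs /cq /rP /rS /rQ /hundual !(mxE, sum3) /=.
case: (w 0 0) => a b; case: (w 0 1) => c d; case: (w 0 ord_max) => e f /=; ring.
Qed.

(** The condition on [cq * rQ] makes the denominators of the inverse chart
    nonzero on this open set of matrices, whatever their determinant; the two
    others say that the column and the row are negative. *)
Definition crown_lift m :=
  [/\ 0 < complex.Re (cq (vec m) * rQ (cov m)), 0 < herm (vec m) &
      0 < hermr (cov m)].

Lemma det_exp_iY (t : R) : \det (hyp (cos t)%:C%C ('i * (sin t)%:C%C) : Mat R) = 1.
Proof.
rewrite det_hyp exprMn sqrCi mulN1r opprK -!rmorphXn /= -rmorphD /=.
by rewrite cos2Dsin2.
Qed.

Lemma crown_lift_invariant m m' : \det m = 1 -> \det m' = 1 ->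
  act m (base_point R) = act m' (base_point R) -> crown_lift m -> crown_lift m'.
Proof.
move=> d d' /(cosetP d d')[z z0 [ev ec]] [h1 h2 h3].
rewrite /crown_lift ev ec siegelZ siegelZr hermZ hermrZ.
split; last 2 first.
- by rewrite mulr_gt0// norm2_gt0.
- by rewrite mulr_gt0// norm2_gt0// invr_eq0.
by rewrite mulrACA mulfV// mul1r.
Qed.

Lemma cos_double_gt0 (t : R) : `|t| < pi / 4 -> 0 < cos (2 * t).
Proof.
move=> t4; apply: cos_gt0_pihalf; rewrite -ltr_norml normrM (ger0_norm (ler0n _ 2)).
by rewrite mulrC -ltr_pdivlMr// -mulrA -invfM -natrM.
Qed.

Lemma crown_lift_of_crown m : \det m = 1 -> crown R (act m (base_point R)) -> crown_lift m.
Proof.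
move=> d [g [Y [Gg [t t4 ->] E]]].
have dg : \det g = 1 by case: Gg.
move: E; rewrite expm_Y; set M := hyp _ _ => E.
have dM : \det M = 1 by exact: det_exp_iY.
apply: crown_lift_invariant (esym E) _ => //; first by rewrite det_mulmx dg dM mulr1.
have c2 : 0 < cos t ^+ 2 - sin t ^+ 2.
  by have := cos_double_gt0 t4; rewrite mulr_natl cos_mulr2n; have := cos2Dsin2 t; lra.
have covM : cov M = f3 *m hyp (cos t)%:C%C (- ('i * (sin t)%:C%C)).
  apply/esym/cov_uniq => //; rewrite -mulmxA hypM.
  rewrite (_ : hyp _ _ = 1%:M) ?mulmx1// -hyp1; congr hyp; last by ring.
  by have := dM; rewrite det_hyp => <-; ring.
have h2 : 0 < herm (vec (g *m M)).
  rewrite vecM herm_SU21// vecE /herm !siegel_hyp !siegel_e3.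
  by rewrite iE /=; have := c2; rewrite !expr2; lra.
have h3 : 0 < hermr (cov (g *m M)).
  rewrite cov_mulmx// hermr_SU21// covM /hermr !siegel_hyp_row !siegel_f3.
  by rewrite iE /=; have := c2; rewrite !expr2; lra.
have dgM : \det (g *m M) = 1 by rewrite det_mulmx dg dM mulr1.
split=> //; apply: siegel_half_plane => //.
by rewrite cov_vec// mxE.
Qed.

Definition rot_mx (a b : C) : Mat R :=
  mx3 [:: [:: a; - b^*; 0]; [:: b; a^*; 0]; [:: 0; 0; 1]].

Lemma SU21_rot (a b : C) : a * a^* + b * b^* = 1 -> SU21 R (rot_mx a b).
Proof.
move=> ab; split; last by rewrite det_mx3 -[RHS]ab; ring.
rewrite conj_mx3T !rmorphN /= !conjCK !rmorph0 rmorph1 [X in X *m _]mulmx3 [LHS]mulmx3.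
by congr mx3; do ![congr (_ :: _)]; first [ring | rewrite -[RHS]ab; ring].
Qed.

(** Any vector of length [s] in the plane of the first two coordinates is the image of
    [i s] times the first basis vector under SU(2); for [s = 0] both are
    zero and the rotation is arbitrary. *)
Lemma rot_exists (s : R) (z1 z2 : C) : z1 * z1^* + z2 * z2^* = (s ^+ 2)%:C%C ->
  exists a b : C, [/\ a * a^* + b * b^* = 1, 'i * s%:C%C * a = z1 & 'i * s%:C%C * b = z2].
Proof.
have [->|s0] := eqVneq s 0.
  rewrite !normJE -rmorphD expr0n /= => /complexI /eqP.
  rewrite !paddr_eq0 ?addr_ge0 ?sqr_ge0// !sqrf_eq0 => /andP[z10 z20].
  exists 1, 0; rewrite rmorph1 rmorph0 !mulr0 mul0r addr0 mulr1.
  by split=> //; apply/esym/eqP; rewrite eq_complex.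
move=> E; have i0 : 'i * s%:C%C != 0 :> C.
  by rewrite mulf_neq0 ?neq0Ci// fmorph_eq0.
exists (z1 / ('i * s%:C%C)), (z2 / ('i * s%:C%C)).
have c0 : ('i * s%:C%C)^* = - ('i * s%:C%C) :> C by rewrite rmorphM /= conjCi conjR mulNr.
split; [|by rewrite mulrC divfK|by rewrite mulrC divfK].
rewrite !rmorphM /= !fmorphV /= c0.
have aux (k : C) : k != 0 -> z1 / k * (z1^* / - k) + z2 / k * (z2^* / - k) =
   - (z1 * z1^* + z2 * z2^*) / k ^+ 2 by move=> k0; field.
rewrite aux//.
by rewrite E exprMn sqrCi rmorphXn mulN1r invrN mulrNN mulfV// expf_neq0// fmorph_eq0.
Qed.

Lemma real_half (x : R) : (x / 2)%:C%C = x%:C%C / 2 :> C.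
Proof. by rewrite (rmorphM (real_complex R)) /= fmorphV rmorph_nat. Qed.

(** Two negative lines are the images of a pair [exp(iY_t) e3], [exp(-iY_t) e3].
    After rescaling [v] and the vector [u] dual to [w] to the same
    norm [- c], their half sum [x] and half difference [y] are orthogonal; [x] is
    negative, so [NA] brings it to a multiple of [e3], and then [y] lies in the plane of
    the first two coordinates, where a rotation in SU(2) brings it to the first
    axis.  The angle is given by [cos (2 t) = c]. *)
Lemma crown_of_crown_lift m : \det m = 1 -> crown_lift m -> crown R (act m (base_point R)).
Proof.
move=> dm [_ hv hw].
(* scaling [v] by [l] and [w] by [l^-1] makes the two norms equal to [c] *)
pose l := Num.sqrt (Num.sqrt (hermr (cov m) / herm (vec m))).
have l0 : 0 < l by rewrite !sqrtr_gt0 divr_gt0.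
pose L : C := l%:C%C; have L0 : L != 0 by rewrite fmorph_eq0 gt_eqF.
pose c := l ^+ 2 * herm (vec m).
have c0 : 0 < c by rewrite mulr_gt0// exprn_gt0.
have cE : l ^- 2 * hermr (cov m) = c.
  have l4 : l ^+ 2 * l ^+ 2 * herm (vec m) = hermr (cov m).
    by rewrite -expr2 !sqr_sqrtr ?sqrtr_ge0 ?divfK ?gt_eqF// divr_ge0// ltW.
  by rewrite -l4 /c; field; rewrite gt_eqF.
pose v := L *: vec m; pose u := hundual (L^-1 *: cov m).
have vv : hpair v v = c%:C%C by rewrite hpair_herm hermZ /= expr0n addr0.
have uu : hpair u u = c%:C%C.
  rewrite hpair_herm herm_hundual hermrZ.
  have -> : L^-1 = (l^-1)%:C%C by rewrite fmorphV.
  by rewrite /= expr0n addr0 exprVn cE.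
have uv : hpair u v = 1.
  by rewrite /hpair hdualK -scalemxAl -scalemxAr scalerA mulVf// scale1r cov_vec// mxE.
have vu : hpair v u = 1 by rewrite -hpair_conj uv rmorph1.
have vE : v = L *: vec m by []. 
have uE : u = hundual (L^-1 *: cov m) by [].
move: v u vE uE vv uu uv vu => v u vE uE vv uu uv vu.
(* [x] and [y] are orthogonal because [v] and [u] have the same norm and a real product *)
pose x := 2^-1 *: (v + u); pose y := 2^-1 *: (v + (-1) *: u).
have c2 : (2^-1)^* = 2^-1 :> C by rewrite fmorphV rmorph_nat.
have N1 : (-1)^* = -1 :> C by rewrite rmorphN1.
have xx : hpair x x = ((1 + c) / 2)%:C%C.
  rewrite hpairZl hpairZr c2 hpairDl !hpairDr vv uu uv vu.
  by rewrite real_half (rmorphD (real_complex R)) rmorph1 /=; field.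
have xy : hpair x y = 0.
  by rewrite hpairZl hpairZr c2 hpairDl !hpairDr !hpairZr vv uu uv vu; ring.
have yy : hpair y y = (- ((1 - c) / 2))%:C%C.
  rewrite hpairZl hpairZr c2 hpairDl !hpairDr !hpairZl !hpairZr N1 vv uu uv vu.
  by rewrite (rmorphN (real_complex R)) /= real_half (rmorphB (real_complex R)) rmorph1 /=; field.
have xyv : x + y = v.
  by rewrite /x /y; apply/matrixP => i j; rewrite !mxE; field.
have xyu : x - y = u.
  by rewrite /x /y; apply/matrixP => i j; rewrite !mxE; field.
move: x y xx xy yy xyv xyu => x y xx xy yy xyv xyu.
have hx : herm x = (1 + c) / 2 by apply: complexI; rewrite -hpair_herm.
have [a [b [r [z xE]]]] : exists a b t z, x = z *: (unipN a b *m elt_a t *m e3).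
  by apply: NA_transitive; rewrite hx; lra.
pose g0 : Mat R := unipN a b *m elt_a r.
have G0 : SU21 R g0 by apply: SU21M; [exact: SU21_unipN | exact: SU21_elt_a].
have d0 : \det g0 = 1 by case: G0.
have {}xE : x = z *: (g0 *m e3) by [].
move: g0 xE G0 d0 => g0 xE G0 d0.
have e33 : hpair e3 e3 = 1 by rewrite hpairE !mxE /= rmorph1 rmorph0; ring.
have zz : z * z^* = ((1 + c) / 2)%:C%C.
  by rewrite -xx xE hpairZl hpairZr hpair_SU21// e33; ring.
have z0 : z != 0.
  apply/eqP => z0; move: zz; rewrite z0 mul0r => /complexI; lra.
pose y0 := \adj g0 *m y.
have yE : y = g0 *m y0 by rewrite /y0 mulmxA mul_adj// mul1mx.
move: y0 yE => y0 yE.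
have y02 : y0 ord_max 0 = 0.
  have : hpair x y = z^* * hpair e3 y0 by rewrite xE yE hpairZl hpair_SU21.
  rewrite xy hpairE !mxE /= rmorph1 rmorph0 => /esym/eqP.
  by rewrite mulf_eq0 conjC_eq0 (negbTE z0) /= !mul0r !subr0 mul1r => /eqP.
have y0n : y0 0 0 * (y0 0 0)^* + y0 1 0 * (y0 1 0)^* = ((1 - c) / 2)%:C%C.
  have : hpair y y = hpair y0 y0 by rewrite yE hpair_SU21.
  rewrite yy hpairE y02 mulr0 sub0r rmorphN /= => E.
  by rewrite -[RHS]opprK E; ring.
have c1 : c <= 1.
  have : 0 <= (1 - c) / 2.
    rewrite -lecR -[X in _ <= X]y0n !normJE -rmorphD lecR.
    by rewrite addr_ge0// addr_ge0// sqr_ge0.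
  lra.
pose t := acos c / 2.
have ct : cos (2 * t) = c.
  rewrite /t mulrC divfK//; apply: acosK; rewrite in_itv/= c1 andbT; lra.
have t4 : `|t| < pi / 4.
  have t0 : 0 <= t by rewrite divr_ge0// acos_ge0// c1 andbT; lra.
  rewrite ger0_norm// /t.
  have : acos c < pi / 2.
    rewrite -ltr_cos ?in_itv/= ?acos_ge0 ?acos_lepi ?pihalf_ge0//; try lra.
    by rewrite acosK ?in_itv/= ?cos_pihalf//; lra.
    by have := pi_ge0 R; lra.
  lra.
have ct0 : 0 < cos t.
  apply: cos_gt0_pihalf; rewrite -ltr_norml (lt_le_trans t4)//.
  by have := pi_ge0 R; lra.
have C2 : cos t ^+ 2 = (1 + c) / 2.
  by move: ct; rewrite mulr_natl cos_mulr2n => <-; field.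
have S2 : sin t ^+ 2 = (1 - c) / 2.
  by have := cos2Dsin2 t; rewrite C2; lra.
pose Ct : C := (cos t)%:C%C; have Ct0 : Ct != 0 by rewrite fmorph_eq0 gt_eqF.
(* the phase of the multiple of [e3] to which [x] is brought *)
pose mu := z / Ct.
have zmu : z = mu * Ct by rewrite divfK.
have mumu : mu * mu^* = 1.
  rewrite /mu rmorphM fmorphV /= conjR mulrACA zz -C2 -invfM -rmorphM -expr2.
  by rewrite mulfV// fmorph_eq0 expf_neq0// gt_eqF.
move: mu zmu mumu => mu zmu mumu.
have [a' [b' [ab a'E b'E]]] : exists a' b' : C, [/\ a' * a'^* + b' * b'^* = 1,
    'i * (sin t)%:C%C * a' = mu^* * y0 0 0 & 'i * (sin t)%:C%C * b' = mu^* * y0 1 0].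
  apply: rot_exists; rewrite S2 -y0n !rmorphM /= conjCK.
  transitivity ((mu * mu^*) * (y0 0 0 * (y0 0 0)^* + y0 1 0 * (y0 1 0)^*)); first by ring.
  by rewrite mumu mul1r.
pose g := g0 *m rot_mx a' b'.
have Gg : SU21 R g by apply: SU21M => //; exact: SU21_rot.
have dg : \det g = 1 by case: Gg.
exists g, (elt_Y t); split=> //; first by exists t.
rewrite expm_Y -/Ct; set M := hyp _ _.
have dM : \det M = 1 by exact: det_exp_iY.
have dgM : \det (g *m M) = 1 by rewrite det_mulmx dg dM mulr1.
have muK : mu^* * z = Ct by rewrite zmu mulrA [mu^* * _]mulrC mumu mul1r.
have ME : rot_mx a' b' *m (M *m e3) = mu^* *: y0 + Ct *: e3.
  apply/matrixP => i j; rewrite ord1; elim/I3_ind: i;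
    rewrite !(mxE, sum3) /= ?y02 -?a'E -?b'E; ring.
have M'E : rot_mx a' b' *m (hyp Ct (- ('i * (sin t)%:C%C)) *m e3) =
    - (mu^* *: y0) + Ct *: e3.
  apply/matrixP => i j; rewrite ord1; elim/I3_ind: i;
    rewrite !(mxE, sum3) /= ?y02 -?a'E -?b'E; ring.
have g0e : z *: (g0 *m e3) = x by [].
have vgM : vec (g *m M) = (mu^* * L) *: vec m.
  rewrite vecE /g -!mulmxA ME mulmxDr -!scalemxAr -yE -muK -!scalerA g0e -scalerDr.
  by rewrite addrC xyv vE scalerA.
apply/cosetP => //; exists (mu^* * L).
  by rewrite mulf_neq0// conjC_eq0; apply: contra_eq_neq mumu => ->; rewrite mul0r eq_sym oner_neq0.
split=> //; apply/esym/cov_uniq => //.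
have -> : (mu^* * L)^-1 = mu * L^-1.
  rewrite invfM; congr (_ * _).
  have mc0 : mu^* != 0 by apply: contra_eq_neq mumu => ->; rewrite mulr0 eq_sym oner_neq0.
  by apply: (mulIf mc0); rewrite mulVf// mumu.
rewrite -scalerA -[L^-1 *: cov m]hdualK -uE.
have uE' : u = g *m (mu *: (hyp Ct (- ('i * (sin t)%:C%C)) *m e3)).
  rewrite /g -mulmxA -!scalemxAr M'E mulmxDr mulmxN -!scalemxAr -yE.
  by rewrite scalerDr scalerN !scalerA mumu -zmu scale1r g0e addrC xyu.
rewrite uE' mulmxA -scalemxAl hdual_mul// hdualZ scalerA mumu scale1r.
have -> : hdual (hyp Ct (- ('i * (sin t)%:C%C)) *m e3) = f3 *m hyp Ct (- ('i * (sin t)%:C%C)).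
  apply/matrixP => i j; rewrite ord1 /hdual !(mxE, sum3) /=.
  elim/I3_ind: j; rewrite /= !(rmorphN, rmorphD, rmorphM, rmorph0, rmorph1) /= ?conjCi ?conjR; ring.
rewrite -mulmxA hypM (_ : hyp _ _ = 1%:M) ?mulmx1// -hyp1; congr hyp; last by ring.
by have := dM; rewrite det_hyp => <-; ring.
Qed.

Lemma crown_liftP m : \det m = 1 -> crown R (act m (base_point R)) <-> crown_lift m.
Proof. by move=> dm; split; [exact: crown_lift_of_crown | exact: crown_of_crown_lift]. Qed.

End Crown.

(** * Polar coordinates in the right half-plane *)

Section Polar.
Context {R : realType}.
Local Notation C := R[i].

(** These invert [k = exp (-2 (r + i t))] in the right half-plane. *)
Definition log_radius (k : C) : R :=
  - (ln (complex.Re k ^+ 2 + complex.Im k ^+ 2) / 4).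
Definition half_angle (k : C) : R := - (atan (complex.Im k / complex.Re k) / 2).
Definition phase (t : R) : C := (cos t)%:C%C + 'i * (sin t)%:C%C.

Lemma phaseE t : phase t = (cos t +i* sin t)%C.
Proof. by apply/eqP; rewrite eq_complex /=; apply/andP; split; apply/eqP; ring. Qed.

Lemma phase_sqr t : phase t * phase t = phase (2 * t).
Proof.
rewrite !phaseE mulr_natl cos_mulr2n sin_mulr2n; apply/eqP; rewrite eq_complex /=.
by have := cos2Dsin2 t => cs; apply/andP; split; apply/eqP; first (rewrite -[in RHS]cs; ring); ring.
Qed.

Lemma phaseN t : phase t * phase (- t) = 1.
Proof.
rewrite !phaseE cosN sinN; apply/eqP; rewrite eq_complex /=.
apply/andP; split; apply/eqP; last by ring.
by rewrite -[RHS](cos2Dsin2 t); ring.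
Qed.

Lemma expR_phase_sqr r t : ((expR r)%:C%C * phase t) ^+ 2 =
  (expR (2 * r) * cos (2 * t) +i* (expR (2 * r) * sin (2 * t)))%C.
Proof.
rewrite expr2 mulrACA phase_sqr phaseE -rmorphM -expRD -mulr2n -[r *+ 2]mulr_natl.
by apply/eqP; rewrite eq_complex /=; apply/andP; split; apply/eqP; ring.
Qed.

Lemma polar_of_half_plane (k : C) : 0 < complex.Re k ->
  ((expR (- log_radius k))%:C%C * phase (- half_angle k)) ^+ 2 = k /\
  `|half_angle k| < pi / 4.
Proof.
case: k => x y /= x0; rewrite expR_phase_sqr /log_radius /half_angle /= !opprK.
set n := x ^+ 2 + y ^+ 2.
have n0 : 0 < n by rewrite ltr_pwDl ?sqr_ge0// exprn_gt0.
split; last first.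
  have : `|atan (y / x)| < pi / 2 by rewrite ltr_norml atan_gtNpi2 atan_ltpi2.
  rewrite ?normrN normrM (ger0_norm (_ : 0 <= 2^-1)) ?invr_ge0//; lra.
rewrite (_ : 2 * (atan (y / x) / 2) = atan (y / x)); last by field.
rewrite (_ : 2 * (ln n / 4) = ln n / 2); last by field.
set th := atan _; set rho := expR _.
have rho2 : rho ^+ 2 = n by rewrite expr2 -expRD (_ : ln n / 2 + ln n / 2 = ln n) ?lnK//; field.
have c0 : 0 < cos th by apply: cos_gt0_pihalf; rewrite atan_gtNpi2 atan_ltpi2.
have c2 : cos th ^+ 2 = x ^+ 2 / n.
  have := cos2_tan2 (lt0r_neq0 c0); rewrite atanK => E.
  apply: (@invr_inj _); rewrite E /n; field; rewrite -/n ?gt_eqF//.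
have xE : rho * cos th = x.
  apply/eqP; rewrite -(eqrXn2 (_ : 0 < 2)%N) ?mulr_ge0 ?expR_ge0 ?ltW//.
  by rewrite exprMn rho2 c2 mulrCA mulfV ?mulr1// gt_eqF.
congr Complex; first exact: xE.
rewrite -[sin th](divfK (lt0r_neq0 c0)) -/(tan th) atanK.
by rewrite mulrCA xE divfK// gt_eqF.
Qed.

Lemma half_plane_of_polar r t : `|t| < pi / 4 ->
  let k := ((expR (- r))%:C%C * phase (- t)) ^+ 2 in
  [/\ 0 < complex.Re k, log_radius k = r & half_angle k = t].
Proof.
move=> t4 k; rewrite /log_radius /half_angle /k expR_phase_sqr /= mulrN mulrN cosN sinN.
have c0 := cos_double_gt0 t4.
split; first by rewrite mulr_gt0// expR_gt0.
  have -> : (expR (- (2 * r)) * cos (2 * t)) ^+ 2 + (expR (- (2 * r)) * - sin (2 * t)) ^+ 2 =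
      expR (- (2 * r)) ^+ 2.
    by rewrite -[RHS]mulr1 -[X in _ = _ * X](cos2Dsin2 (2 * t)); ring.
  by rewrite expr2 -expRD expRK; field.
rewrite -mulf_div divff ?gt_eqF ?expR_gt0// mul1r mulNr -/(tan _) atanN tanK.
  by field.
rewrite in_itv/= -ltr_norml normrM (ger0_norm (ler0n _ 2)).
by rewrite mulrC -ltr_pdivlMr// -mulrA -invfM -natrM.
Qed.

End Polar.

(** * The chart in Siegel coordinates *)

Section Parametrization.
Context {R : realType}.
Local Notation C := R[i].
Implicit Types (v : 'cV[C]_3) (w : 'rV[C]_3) (m g : Mat R).

(** The matrix [n a_r exp(i Y_t) exp(i Z_(a,b))] with [n = exp Z_(al,be)]. *)
Definition chart (al : C) (be r t : R) (a : C) (b : R) : Mat R :=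
  unipN al be *m elt_a r *m hyp (cos t)%:C%C ('i * (sin t)%:C%C) *m
  unip ('i * a) ('i * a^*) (- b%:C%C + a * a^* / 2).

Lemma det_chart al be r t a b : \det (chart al be r t a b) = 1.
Proof. by rewrite /chart !det_mulmx !det_unip det_elt_a det_exp_iY !mulr1. Qed.

(** The complexified dilation factor [exp (r + i t)]. *)
Definition stretch (r t : R) : C := (expR r)%:C%C * phase t.

Lemma stretchN r t : stretch r t * stretch (- r) (- t) = 1.
Proof. by rewrite /stretch mulrACA phaseN -rmorphM -expRD subrr expR0 mulr1. Qed.

Lemma phase_sum t : (cos t)%:C%C + 'i * (sin t)%:C%C = phase t :> C.
Proof. by []. Qed.

Lemma phase_diff t : (cos t)%:C%C - 'i * (sin t)%:C%C = phase (- t) :> C.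
Proof. by rewrite /phase cosN sinN rmorphN /=; ring. Qed.

Lemma siegel_chart al be r t a b (m := chart al be r t a b) (x := stretch r t)
    (y := stretch (- r) (- t)) :
  [/\ cp (vec m) = x * (1 + 2 * b%:C%C - a * a^*) + 2 * 'i * al * a^*
                   + (al * al^* - 2 * 'i * be%:C%C) * y,
      cs (vec m) = 'i * a^* + al^* * y & cq (vec m) = y].
Proof.
rewrite /m /chart vecE -!mulmxA !siegel_unip !siegel_elt_a !siegel_hyp !siegel_unip.
rewrite !siegel_e3 phase_sum phase_diff.
rewrite /x /y /stretch; split; [by field|ring|ring].
Qed.

(** The inverses of the four factors, in the opposite order. *)
Lemma cov_chart al be r t a b : cov (chart al be r t a b) =
  f3 *m unip (- ('i * a)) (- ('i * a^*)) (b%:C%C + a * a^* / 2) *m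
  hyp (cos (- t))%:C%C ('i * (sin (- t))%:C%C) *m elt_a (- r) *m
  unip (- al) (- al^*) (- ('i * be%:C%C) - al * al^* / 2).
Proof.
apply/esym/cov_uniq; first exact: det_chart.
rewrite /chart.
have i2 : 'i * 'i = -1 :> C by rewrite -expr2 sqrCi.
have h1 : unip (- al) (- al^*) (- ('i * be%:C%C) - al * al^* / 2) *m unipN al be = 1%:M.
  by rewrite unipM -unip0; congr unip; field.
have h2 : elt_a (- r) *m elt_a r = 1%:M :> Mat R.
  rewrite !elt_aE hypM -hyp1; have E : expR r * expR (- r) = 1 by rewrite -expRD subrr expR0.
  rewrite opprK -!rmorphM -!rmorphD /=; congr (hyp _%:C%C _%:C%C).
    by rewrite -[RHS]E; field.
  by field.
have h3 : hyp (cos (- t))%:C%C ('i * (sin (- t))%:C%C) *m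
   hyp (cos t)%:C%C ('i * (sin t)%:C%C) = 1%:M :> Mat R.
  rewrite hypM -hyp1 cosN sinN rmorphN /=; congr hyp; last by ring.
  transitivity ((cos t)%:C%C ^+ 2 - ('i * 'i) * (sin t)%:C%C ^+ 2 : C); first by ring.
  by rewrite i2 mulN1r opprK -!rmorphXn -rmorphD /= cos2Dsin2.
have h4 : unip (- ('i * a)) (- ('i * a^*)) (b%:C%C + a * a^* / 2) *m
   unip ('i * a) ('i * a^*) (- b%:C%C + a * a^* / 2) = 1%:M.
  rewrite unipM -unip0; congr unip; [by ring|by ring|].
  transitivity ((1 + 'i * 'i) * (a * a^*)); first by field.
  by rewrite i2 subrr mul0r.
rewrite -!mulmxA (mulmxA _ (unipN al be)) h1 mul1mx.
rewrite (mulmxA _ (elt_a r)) h2 mul1mx (mulmxA (hyp _ _) (hyp _ _)) h3 mul1mx.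
by rewrite h4 mulmx1.
Qed.

Lemma siegel_chart_cov al be r t a b (m := chart al be r t a b) (x := stretch r t)
    (y := stretch (- r) (- t)) :
  [/\ rP (cov m) = x * (1 - 2 * b%:C%C - a * a^*) + 2 * 'i * al^* * a
                   + (al * al^* + 2 * 'i * be%:C%C) * y,
      rS (cov m) = 'i * a + al * y & rQ (cov m) = y].
Proof.
rewrite /m cov_chart !siegel_unip_row !elt_aE !siegel_hyp_row !siegel_unip_row.
rewrite !siegel_f3 boost_sum boost_diff phase_sum phase_diff !opprK.
rewrite /x /y /stretch; split; [by field|ring|ring].
Qed.

(** The inverse of the chart.  The subgroup [N] leaves [cq v * rQ w] unchanged, while
    [A] and its complexification scale it, which gives [r] and [t].  All the
    formulas only use this product and ratios of coordinates, so they do not depend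
    on the scaling of [v] and [w]. *)
Definition dec_r v w : R := log_radius (cq v * rQ w).
Definition dec_t v w : R := half_angle (cq v * rQ w).
Definition pt1 v : C := cs v / cq v.
Definition pt2 w : C := rS w / rQ w.
(** Half sum and half difference of the [s]-coordinates of the two points of the
    Siegel domain.  On the chart they equal [al^* - a^* e^r sin t] and [a^* e^r cos t] by
    [mean_s_chart] and [diff_s_chart], whence the formulas for [dec_a] and [dec_al]. *)
Definition mean_s v w : C := (pt1 v + (pt2 w)^*) / 2.
Definition diff_s v w : C := (pt1 v - (pt2 w)^*) / (2 * 'i).
Definition slope v w : R := sin (dec_t v w) / cos (dec_t v w).
(** The difference of the [p]-coordinates, which is affine in [b] and [be] by
    [height_eq]. *)
Definition height v w : C := cp v / cq v - rP w / rQ w.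
Definition eta v w : R := complex.Im ((mean_s v w)^* * diff_s v w).
Definition dec_al v w : C := (mean_s v w)^* + (diff_s v w)^* * (slope v w)%:C%C.
Definition dec_a v w : C :=
  (diff_s v w)^* * ((expR (- dec_r v w) / cos (dec_t v w)))%:C%C.
Definition dec_b v w : R :=
  (complex.Re (height v w) / 4 + eta v w) / complex.Re (cq v * rQ w)^-1.
Definition dec_be v w : R :=
  dec_b v w * complex.Im (cq v * rQ w)^-1 - slope v w * eta v w
  - complex.Im (height v w) / 4.

(** One complex equation for two real unknowns: its real part does not contain
    [be], and determines [b]. *)
Lemma height_eq (D W : C) (b be tau et : R) : complex.Re W != 0 ->
  D = 4 * b%:C%C * W - 4 * (1 + 'i * tau%:C%C) * et%:C%C - 4 * 'i * be%:C%C <->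
  b = (complex.Re D / 4 + et) / complex.Re W /\
  be = b * complex.Im W - tau * et - complex.Im D / 4.
Proof.
case: D => d d'; case: W => x y /= x0; split.
  move=> /eqP; rewrite eq_complex /= => /andP[/eqP -> /eqP ->].
  by split; field.
move=> [-> ->]; apply/eqP; rewrite eq_complex /=; apply/andP; split; apply/eqP; field => //.
Qed.

End Parametrization.

(** * Inverting the chart *)

Section Inversion.
Context {R : realType}.
Local Notation C := R[i].
Implicit Types (v : 'cV[C]_3) (w : 'rV[C]_3) (m g : Mat R).

Let i2 : 'i * 'i = -1 :> C. Proof. by rewrite -expr2 sqrCi. Qed.

Lemma Im_twice (z : C) : 2 * 'i * (complex.Im z)%:C%C = z - z^*.
Proof.
by case: z => a b; apply/eqP; rewrite eq_complex /=; apply/andP; split; apply/eqP; ring.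
Qed.

Lemma cos_gt0_piquarter (t : R) : `|t| < pi / 4 -> 0 < cos t.
Proof.
move=> t4; apply: cos_gt0_pihalf; rewrite -ltr_norml (lt_le_trans t4)//.
by have := pi_ge0 R; lra.
Qed.

Lemma phase_slope t : cos t != 0 ->
  phase t = (cos t)%:C%C * (1 + 'i * (sin t / cos t)%:C%C) :> C.
Proof.
move=> c0; rewrite /phase mulrDr mulr1 mulrCA -(rmorphM (real_complex R)) /=.
by rewrite [cos t * _]mulrC divfK.
Qed.

Lemma stretch_conj (r t : R) : (stretch r t)^* = (expR r)%:C%C * phase (- t).
Proof.
rewrite /stretch /phase cosN sinN !rmorphM rmorphD !rmorphM /= conjCi !conjR rmorphN /=.
by ring.
Qed.

Section Decode.
Variables (al a : C) (be r t b : R).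
Hypothesis t4 : `|t| < pi / 4.
Let m := chart al be r t a b.
Let x := stretch r t.
Let y := stretch (- r) (- t).
Let xy : x * y = 1. Proof. exact: stretchN. Qed.
Let y0 : y != 0.
Proof. by apply: contra_eq_neq xy => ->; rewrite mulr0 eq_sym oner_neq0. Qed.
Let yV : y^-1 = x.
Proof. by apply: (mulIf y0); rewrite mulVf// xy. Qed.
Let c0 : cos t != 0.
Proof. by rewrite gt_eqF// cos_gt0_piquarter. Qed.
Let cC0 : (cos t)%:C%C != 0 :> C.
Proof. by rewrite fmorph_eq0. Qed.

Let kE : cq (vec m) * rQ (cov m) = y ^+ 2.
Proof.
have [_ _ ->] := siegel_chart al be r t a b.
by have [_ _ ->] := siegel_chart_cov al be r t a b; rewrite expr2.
Qed.

Lemma dec_r_chart : dec_r (vec m) (cov m) = r.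
Proof. by rewrite /dec_r kE; have [] := half_plane_of_polar r t4. Qed.

Lemma dec_t_chart : dec_t (vec m) (cov m) = t.
Proof. by rewrite /dec_t kE; have [] := half_plane_of_polar r t4. Qed.

Let xE : x = (expR r)%:C%C * (cos t)%:C%C * (1 + 'i * (sin t / cos t)%:C%C).
Proof. by rewrite /x /stretch phase_slope// mulrA. Qed.

Let pt1E : pt1 (vec m) = 'i * a^* * x + al^*.
Proof.
by rewrite /pt1; have [_ -> ->] := siegel_chart al be r t a b; rewrite -/y mulrDl mulfK// yV.
Qed.

Let pt2E : pt2 (cov m) = 'i * a * x + al.
Proof.
by rewrite /pt2; have [_ -> ->] := siegel_chart_cov al be r t a b; rewrite -/y mulrDl mulfK// yV.
Qed.

Let E : C := (expR r)%:C%C.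
Let c : C := (cos t)%:C%C.
Let s : C := (sin t)%:C%C.

Lemma mean_s_chart : mean_s (vec m) (cov m) = al^* - a^* * (E * s).
Proof.
rewrite /mean_s pt1E pt2E /x rmorphD /= [(_ * stretch r t)^*]rmorphM /= stretch_conj !rmorphM /= conjCi.
rewrite /stretch -/E /phase cosN sinN rmorphN /= -/c -/s.
transitivity (al^* + ('i * 'i) * a^* * (E * s)); first by field.
by rewrite i2; ring.
Qed.

Lemma diff_s_chart : diff_s (vec m) (cov m) = a^* * (E * c).
Proof.
rewrite /diff_s pt1E pt2E /x rmorphD /= [(_ * stretch r t)^*]rmorphM /= stretch_conj !rmorphM /= conjCi.
rewrite /stretch -/E /phase cosN sinN rmorphN /= -/c -/s.
by field; exact: neq0Ci.
Qed.

Lemma dec_al_chart : dec_al (vec m) (cov m) = al.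
Proof.
rewrite /dec_al /slope dec_t_chart mean_s_chart diff_s_chart rmorphB !rmorphM /= !conjCK.
rewrite !conjR fmorphV /= -/s -/c; field; exact: cC0.
Qed.

Lemma dec_a_chart : dec_a (vec m) (cov m) = a.
Proof.
rewrite /dec_a dec_r_chart dec_t_chart diff_s_chart !rmorphM /= !conjCK !conjR.
rewrite fmorphV /= -/c -/E expRN fmorphV /= -/E.
have E0 : E != 0 by rewrite fmorph_eq0 gt_eqF// expR_gt0.
by field; rewrite cC0 E0.
Qed.

Lemma dec_bbe_chart : dec_b (vec m) (cov m) = b /\ dec_be (vec m) (cov m) = be.
Proof.
have W0 : complex.Re (x ^+ 2) != 0.
  by rewrite expR_phase_sqr /= gt_eqF// mulr_gt0 ?expR_gt0// cos_double_gt0.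
have WE : (cq (vec m) * rQ (cov m))^-1 = x ^+ 2 by rewrite kE -exprVn yV.
have eE : 2 * 'i * (eta (vec m) (cov m))%:C%C = (E * c) * (al * a^* - al^* * a).
  rewrite /eta Im_twice mean_s_chart diff_s_chart !(rmorphM, rmorphB) /= !conjCK !conjR.
  by rewrite -/E -/c -/s; ring.
have hE : height (vec m) (cov m) =
    4 * b%:C%C * x ^+ 2 - 4 * (1 + 'i * (sin t / cos t)%:C%C) * (eta (vec m) (cov m))%:C%C
    - 4 * 'i * be%:C%C.
  have -> : - (4 * (1 + 'i * (sin t / cos t)%:C%C) * (eta (vec m) (cov m))%:C%C) =
     2 * 'i * (1 + 'i * (sin t / cos t)%:C%C) * (2 * 'i * (eta (vec m) (cov m))%:C%C).
    transitivity (('i * 'i) * (4 * (1 + 'i * (sin t / cos t)%:C%C) * (eta (vec m) (cov m))%:C%C)); last by ring.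
    by rewrite i2 mulN1r.
  rewrite eE /height.
  have [-> _ ->] := siegel_chart al be r t a b.
  have [-> _ ->] := siegel_chart_cov al be r t a b.
  rewrite -/x -/y yV.
  transitivity (4 * b%:C%C * x ^+ 2 + 2 * 'i * x * (al * a^* - al^* * a)
     - 4 * 'i * be%:C%C * (x * y)); first by ring.
  by rewrite xy mulr1 {2}xE -/E -/c; ring.
have [bE beE] := (@height_eq R _ _ _ _ _ _ W0).1 hE.
have bE' : dec_b (vec m) (cov m) = b by rewrite /dec_b WE.
by rewrite /dec_be bE' WE /slope dec_t_chart.
Qed.

End Decode.

(** The only identity behind [chart_decode] that is not linear: it holds modulo
    [i^2 = -1] with no relation between [tau] and the other variables. *)
Lemma chart_polynomial (M M' D D' tau : C) :
  - ((1 + 'i * tau) * D) * ((1 + 'i * tau) * D')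
  + 2 * 'i * ((1 + 'i * tau) * D) * (M' + D' * tau) + (M + D * tau) * (M' + D' * tau)
  = (M + 'i * D) * (M' + 'i * D') + 'i * (1 + 'i * tau) * (M' * D - M * D').
Proof.
transitivity ((M + 'i * D) * (M' + 'i * D') + 'i * (1 + 'i * tau) * (M' * D - M * D')
  + (1 + 'i * 'i) * (D * D' * (tau ^+ 2 - 1) + tau * (D * M' + M * D'))); first by ring.
by rewrite i2 subrr mul0r addr0.
Qed.

Section Encode.
Variables (v : 'cV[C]_3) (w : 'rV[C]_3).
Hypothesis wv : (w *m v) 0 0 = 1.
Hypothesis k0 : 0 < complex.Re (cq v * rQ w).
Let r := dec_r v w.
Let t := dec_t v w.
Let a := dec_a v w.
Let al := dec_al v w.
Let b := dec_b v w.
Let be := dec_be v w.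
Let m := chart al be r t a b.
Let x := stretch r t.
Let y := stretch (- r) (- t).
Let tau : C := (slope v w)%:C%C.
Let M := mean_s v w.
Let D := diff_s v w.

Let xy : x * y = 1. Proof. exact: stretchN. Qed.
Let y0 : y != 0.
Proof. by apply: contra_eq_neq xy => ->; rewrite mulr0 eq_sym oner_neq0. Qed.
Let x0 : x != 0.
Proof. by apply: contra_eq_neq xy => ->; rewrite mul0r eq_sym oner_neq0. Qed.
Let yE : y ^+ 2 = cq v * rQ w. Proof. exact: (polar_of_half_plane k0).1. Qed.
Lemma dec_t_bound : `|t| < pi / 4. Proof. exact: (polar_of_half_plane k0).2. Qed.
Let c0 : cos t != 0. Proof. by rewrite gt_eqF// cos_gt0_piquarter// dec_t_bound. Qed.
Let q0 : cq v != 0.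
Proof. by move: (Re_gt0_neq0 k0); rewrite mulf_eq0 negb_or => /andP[]. Qed.
Let Q0 : rQ w != 0.
Proof. by move: (Re_gt0_neq0 k0); rewrite mulf_eq0 negb_or => /andP[]. Qed.

Let E1 : (expR (- r) / cos t)%:C%C * ((expR r)%:C%C * (cos t)%:C%C) = 1 :> C.
Proof.
rewrite -!(rmorphM (real_complex R)) /=.
suff -> : expR (- r) / cos t * (expR r * cos t) = 1 by [].
by rewrite mulrACA -expRD addNr expR0 mul1r mulVf.
Qed.

Let xE : x = ((expR r)%:C%C * (cos t)%:C%C) * (1 + 'i * tau).
Proof. by rewrite /x /stretch phase_slope// mulrA. Qed.

Let axE : a * x = (1 + 'i * tau) * D^*.
Proof.
rewrite xE /a /dec_a -/r -/t -/D.
rewrite -[RHS]mul1r -[X in X * ((1 + _) * _)]E1; ring.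
Qed.

Let acxE : a^* * x = (1 + 'i * tau) * D.
Proof.
rewrite xE /a /dec_a -/r -/t -/D rmorphM /= conjCK conjR.
rewrite -[RHS]mul1r -[X in X * ((1 + _) * _)]E1; ring.
Qed.

Let alE : al = M^* + D^* * tau. Proof. by []. Qed.

Let alcE : al^* = M + D * tau.
Proof. by rewrite alE rmorphD rmorphM /= !conjCK conjR. Qed.

Let pt1E : M + 'i * D = pt1 v.
Proof. by rewrite /M /D /mean_s /diff_s; field; exact: neq0Ci. Qed.

Let pt2E : M^* + 'i * D^* = pt2 w.
Proof.
rewrite /M /D /mean_s /diff_s; move: (pt1 v) (pt2 w) => A B.
have -> : ((A + B^*) / 2)^* = (A^* + B) / 2.
  by rewrite rmorphM rmorphD fmorphV rmorph_nat /= conjCK.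
have -> : ((A - B^*) / (2 * 'i))^* = (A^* - B) / (2 * - 'i).
  by rewrite rmorphM rmorphB fmorphV rmorphM rmorph_nat /= conjCi conjCK.
by field; exact: neq0Ci.
Qed.

Let etaE : 'i * (1 + 'i * tau) * (M^* * D - M * D^*) =
  - (2 * (1 + 'i * tau) * (eta v w)%:C%C).
Proof.
have := Im_twice (M^* * D); rewrite -/(eta v w) [(M^* * D)^*]rmorphM /= conjCK => <-.
transitivity (('i * 'i) * (2 * (1 + 'i * tau) * (eta v w)%:C%C)); first by ring.
by rewrite i2 mulN1r.
Qed.

Let WE : (cq v * rQ w)^-1 = x ^+ 2.
Proof.
rewrite -yE -exprVn; congr (_ ^+ 2).
by apply: (mulIf y0); rewrite mulVf// xy.
Qed.

Let heightE : height v w = 4 * b%:C%C * x ^+ 2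
  - 4 * (1 + 'i * tau) * (eta v w)%:C%C - 4 * 'i * be%:C%C.
Proof.
have W0 : complex.Re (x ^+ 2) != 0.
  by rewrite expR_phase_sqr /= gt_eqF// mulr_gt0 ?expR_gt0// cos_double_gt0// dec_t_bound.
by apply/(@height_eq R _ _ _ _ _ _ W0); rewrite /be /dec_be -/b /b /dec_b WE.
Qed.

Let meanE : cp v / cq v + rP w / rQ w = 2 * (x ^+ 2 + pt1 v * pt2 w).
Proof.
rewrite -WE /pt1 /pt2.
have -> : (cq v * rQ w)^-1 = (cq v * rQ w)^-1 *
    ((cp v * rQ w + cq v * rP w) / 2 - cs v * rS w).
  by rewrite -siegel_pairing wv mulr1.
by field; rewrite q0 Q0.
Qed.

Let key1 : x ^+ 2 * (1 + 2 * b%:C%C - a * a^*) + 2 * 'i * al * (a^* * x)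
  + (al * al^* - 2 * 'i * be%:C%C) = cp v / cq v.
Proof.
have -> : cp v / cq v = ((cp v / cq v + rP w / rQ w) + height v w) / 2.
  by rewrite /height; field; rewrite q0 Q0.
rewrite meanE heightE -pt1E -pt2E.
have := chart_polynomial M M^* D D^* tau; rewrite etaE => E2.
have -> : (M + 'i * D) * (M^* + 'i * D^*) =
  - ((1 + 'i * tau) * D) * ((1 + 'i * tau) * D^*)
  + 2 * 'i * ((1 + 'i * tau) * D) * (M^* + D^* * tau) + (M + D * tau) * (M^* + D^* * tau)
  + 2 * (1 + 'i * tau) * (eta v w)%:C%C by rewrite E2; ring.
by rewrite -alcE -alE -axE -acxE; field.
Qed.

Let key2 : x ^+ 2 * (1 - 2 * b%:C%C - a * a^*) + 2 * 'i * al^* * (a * x)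
  + (al * al^* + 2 * 'i * be%:C%C) = rP w / rQ w.
Proof.
have -> : rP w / rQ w = ((cp v / cq v + rP w / rQ w) - height v w) / 2.
  by rewrite /height; field; rewrite q0 Q0.
rewrite meanE heightE -pt1E -pt2E.
have := chart_polynomial M^* M D^* D tau.
have -> : 'i * (1 + 'i * tau) * (M * D^* - M^* * D) =
  2 * (1 + 'i * tau) * (eta v w)%:C%C by apply: oppr_inj; rewrite -etaE; ring.
move=> E2.
have -> : (M + 'i * D) * (M^* + 'i * D^*) =
  - ((1 + 'i * tau) * D^*) * ((1 + 'i * tau) * D)
  + 2 * 'i * ((1 + 'i * tau) * D^*) * (M + D * tau) + (M^* + D^* * tau) * (M + D * tau)
  - 2 * (1 + 'i * tau) * (eta v w)%:C%C by rewrite E2; ring.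
by rewrite -alcE -alE -axE -acxE; field.
Qed.

(** The coordinates are compared one at a time with those of the given column and
    row.  The half sum of the [p]-coordinates is imposed by the pairing, and their
    half difference by the choice of [b] and [be]. *)
Lemma chart_decode : exists2 z : C, z != 0 & vec m = z *: v /\ cov m = z^-1 *: w.
Proof.
exists (y / cq v); first by rewrite mulf_neq0// invr_eq0.
have [P1 S1 Q1] := siegel_chart al be r t a b.
have [P2 S2 Q2] := siegel_chart_cov al be r t a b.
have xV : x = y^-1 by apply: (mulIf y0); rewrite mulVf// xy.
have zV : (y / cq v)^-1 = y / rQ w.
  rewrite invf_div; apply: (mulIf y0); rewrite divfK//.
  by rewrite mulrAC -expr2 yE mulfK.
split.
  apply: siegel_vec_inj; rewrite siegelZ.
  - rewrite P1 -/x -/y [RHS](_ : _ = y * (cp v / cq v)); last by ring.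
    rewrite -key1; transitivity (x * y * (x * (1 + 2 * b%:C%C - a * a^*)) +
      2 * 'i * al * a^* * (x * y) + (al * al^* - 2 * 'i * be%:C%C) * y).
      by rewrite xy; ring.
    by ring.
  - rewrite S1 -/y [RHS](_ : _ = y * pt1 v); last by rewrite /pt1; ring.
    rewrite -pt1E mulrC; apply: (mulIf x0).
    transitivity (('i * (a^* * x) + al^* * (x * y)) : C); first by rewrite /y; ring.
    rewrite acxE xy alcE mulr1.
    transitivity ((x * y) * (M + 'i * D)); last by ring.
    rewrite xy mul1r; transitivity (M + 'i * D + (1 + 'i * 'i) * (D * tau)); first by ring.
    by rewrite i2 subrr mul0r addr0.
  by rewrite Q1 -/y divfK.
rewrite zV; apply: siegel_cov_inj; rewrite siegelZr.
- rewrite P2 -/x -/y [RHS](_ : _ = y * (rP w / rQ w)); last by ring.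
  rewrite -key2; transitivity (x * y * (x * (1 - 2 * b%:C%C - a * a^*)) +
    2 * 'i * al^* * a * (x * y) + (al * al^* + 2 * 'i * be%:C%C) * y).
    by rewrite xy; ring.
  by ring.
- rewrite S2 -/y [RHS](_ : _ = y * pt2 w); last by rewrite /pt2; ring.
  rewrite -pt2E; apply: (mulIf x0).
  transitivity (('i * (a * x) + al * (x * y)) : C); first by ring.
  rewrite axE xy alE mulr1.
  transitivity ((x * y) * (M^* + 'i * D^*)); last by ring.
  rewrite xy mul1r; transitivity (M^* + 'i * D^* + (1 + 'i * 'i) * (D^* * tau)); first by ring.
  by rewrite i2 subrr mul0r addr0.
by rewrite Q2 -/y divfK.
Qed.

End Encode.
End Inversion.

(** * The domain D *)

Section Domain.
Context {R : realType}.
Local Notation C := R[i].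

Lemma norm2E (a : C) : complex.Re `|a| ^+ 2 = complex.Re a ^+ 2 + complex.Im a ^+ 2.
Proof. by rewrite normc_def /= sqr_sqrtr// addr_ge0 ?sqr_ge0. Qed.

Definition to_coords (m : Mat R) : Mcoords R :=
  (map_mx (@complex.Re R) m, map_mx (@complex.Im R) m).

Lemma to_coordsK m : of_coords (to_coords m) = m.
Proof. by apply/matrixP => i j; rewrite !mxE; case: (m i j). Qed.

Lemma of_coordsZ (l : R) p : of_coords (l *: p) = l%:C%C *: of_coords p.
Proof.
apply/matrixP => i j; rewrite !mxE; apply/eqP; rewrite eq_complex /=.
by apply/andP; split; apply/eqP; ring.
Qed.

Lemma elt_YZ (l t : R) : l%:C%C *: elt_Y t = elt_Y (l * t) :> Mat R.
Proof.
mx3_entries; rewrite !mxE /= ?mulr0//; apply/eqP; rewrite eq_complex /=;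
by apply/andP; split; apply/eqP; ring.
Qed.

Lemma elt_ZZ (l : R) (a : C) b : l%:C%C *: elt_Z a b = elt_Z (l%:C%C * a) (l * b) :> Mat R.
Proof.
by mx3_entries; rewrite !mxE /= ?mulr0// ?rmorphM /= ?conjR ?mulrN//; ring.
Qed.

Definition in_domain (t : R) (a : C) (b : R) :=
  `|t| < pi / 4 /\
  (1 - 2 * complex.Re `|a| ^+ 2 - 2 * `|b|) * cos (2 * t) >
  (1 - cos (2 * t)) * complex.Re `|a| ^+ 2.

(** The part [|t| < pi/4] is star-shaped because the cosine decreases with
    the absolute value of the angle. *)
Lemma in_domain_star l t a b : 0 <= l <= 1 -> in_domain t a b ->
  in_domain (l * t) (l%:C%C * a) (l * b).
Proof.
move=> /andP[l0 l1] [t4 H].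
have lt4 : `|l * t| < pi / 4.
  by rewrite normrM (ger0_norm l0) (le_lt_trans _ t4)// ler_piMl.
split=> //.
have c0 := cos_double_gt0 t4; have c1 := cos_le1 (2 * t).
have lc : cos (2 * t) <= cos (2 * (l * t)).
  rewrite -[cos (2 * t)]cos_norm -[cos (2 * (l * t))]cos_norm.
  have b2 (s : R) : `|s| < pi / 4 -> `|2 * s| \in `[0, pi]%R.
    move=> s4; rewrite in_itv /= normr_ge0 /= normrM (ger0_norm (ler0n _ 2)).
    by have := pi_ge0 R; lra.
  rewrite leNgt ltr_cos ?b2// -leNgt [2 * (l * t)]mulrCA.
  by rewrite [`|l * _|]normrM (ger0_norm l0) ler_piMl.
move: H; rewrite !norm2E normrM (ger0_norm l0).
have -> : complex.Re (l%:C%C * a) ^+ 2 + complex.Im (l%:C%C * a) ^+ 2 =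
   l ^+ 2 * (complex.Re a ^+ 2 + complex.Im a ^+ 2).
  by case: a => x y /=; ring.
set A := complex.Re a ^+ 2 + complex.Im a ^+ 2; set B := `|b|.
set c := cos (2 * t) in c0 c1 lc *; set c' := cos (2 * (l * t)) in lc *.
have A0 : 0 <= A by rewrite addr_ge0 ?sqr_ge0.
have B0 : 0 <= B := normr_ge0 b.
have c'1 : c' <= 1 := cos_le1 _.
move=> H.
have l2 : l ^+ 2 <= 1 by rewrite expr_le1.
(* rewritten as c (1 - A - 2 B) > A, the condition is monotone in each quantity *)
have H1 : A < c * (1 - A - 2 * B) by lra.
have H2 : 0 < 1 - A - 2 * B.
  by rewrite -(pmulr_rgt0 _ c0); lra.
have lA : l ^+ 2 * A <= A by rewrite ler_piMl.
have lB : l * B <= B by rewrite ler_piMl.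
have H3 : c * (1 - A - 2 * B) <= c' * (1 - A - 2 * B) by rewrite ler_wpM2r// ltW.
have H4 : c' * (1 - A - 2 * B) <= c' * (1 - l ^+ 2 * A - 2 * (l * B)).
  by rewrite ler_wpM2l ?(le_trans (ltW c0))//; lra.
lra.
Qed.

Lemma of_coords2_star l p : of_coords2 (l *: p) =
   (l%:C%C *: (@of_coords2 R p).1, l%:C%C *: (of_coords2 p).2).
Proof. by rewrite /of_coords2 /= !of_coordsZ. Qed.

(** At [|t| = pi/4] the inequality fails, since it would read
    [0 > |a|^2]; by connectedness [t] cannot cross this value.  Conversely the
    part [|t| < pi/4] is star-shaped. *)
Lemma domDP (p : Mat R * Mat R) : domD R p <->
  exists t a b, p = (elt_Y t, elt_Z a b) /\ in_domain t a b.
Proof.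
split.
  move=> [q [K [K0 KD cK] Kq] <-].
  have D0 q' : K q' -> exists t a b, of_coords2 q' = (elt_Y t, elt_Z a b) /\
     (1 - 2 * complex.Re `|a| ^+ 2 - 2 * `|b|) * cos (2 * t) >
     (1 - cos (2 * t)) * complex.Re `|a| ^+ 2 by move=> /KD.
  pose tau (q' : Mcoords R * Mcoords R) : R := q'.1.1 0 ord_max.
  have tauE q' t Z : of_coords2 q' = (elt_Y t, Z) -> tau q' = t.
    by case=> /(congr1 (fun m : Mat R => m 0 ord_max)); rewrite !mxE /= => -[].
  have [t [a [b [qE H]]]] := D0 q Kq.
  exists t, a, b; split=> //; split=> //.
  have ctau : continuous tau.
    move=> x; apply: (@continuous_comp _ _ _ (fun q' : Mcoords R * Mcoords R => q'.1.1)
      (fun m : 'M[R]_3 => m 0 ord_max)).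
      apply: (@continuous_comp _ _ _ (fun q' : Mcoords R * Mcoords R => q'.1) (fun q' => q'.1)); exact: cvg_fst.
    exact: coord_continuous.
  have citv : is_interval (tau @` K).
    apply/connected_intervalP; apply: connected_continuous_connected => //.
    exact: continuous_subspaceT.
  have tau0 : tau 0 = 0 by rewrite /tau /= mxE.
  rewrite ltNge; apply/negP => t4.
  have [s Ks cs0] : exists2 s, (tau @` K) s & cos (2 * s) = 0.
    have e : 2 * (pi / 4) = pi / 2 :> R by field.
    have [t0|t0] := leP 0 t.
      exists (pi / 4); last by rewrite e cos_pihalf.
      apply: (citv 0 t); [by exists 0|by exists q => //; exact: tauE qE|].
      by rewrite divr_ge0 ?pi_ge0//=; move: t4; rewrite ger0_norm.
    exists (- (pi / 4)); last by rewrite mulrN cosN e cos_pihalf.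
    apply: (citv t 0); [by exists q => //; exact: tauE qE|by exists 0|].
    rewrite oppr_le0 divr_ge0 ?pi_ge0//= andbT.
    by move: t4; rewrite ltr0_norm// lerNr.
  case: Ks => q' Kq' tq'.
  have [t' [a' [b' [qE' H']]]] := D0 q' Kq'.
  move: H'; rewrite -(tauE _ _ _ qE') tq' cs0 mulr0 subr0 mul1r.
  by rewrite ltNge sqr_ge0.
move=> [t [a [b [-> D]]]].
pose q : Mcoords R * Mcoords R := (to_coords (elt_Y t), to_coords (elt_Z a b)).
have qE : of_coords2 q = (elt_Y t, elt_Z a b) by rewrite /of_coords2 /= !to_coordsK.
exists q => //.
exists ((fun l : R => l *: q) @` `[0, 1]); last first.
  by exists 1; [rewrite /= in_itv /= ler01 lexx | rewrite scale1r].
split.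
- by exists 0; [rewrite /= in_itv /= lexx ler01 | rewrite scale0r].
- move=> _ [l l01 <-]; exists (l * t), (l%:C%C * a), (l * b).
  have l01' : 0 <= l <= 1 by move: l01; rewrite /= in_itv.
  by rewrite of_coords2_star qE /= elt_YZ elt_ZZ; split=> //; have [] := in_domain_star l01' D.
apply: connected_continuous_connected; first exact: segment_connected.
by apply: continuous_subspaceT; exact: scalel_continuous.
Qed.

End Domain.

(** * The map as a chart *)

Section Coordinates.
Context {R : realType}.
Local Notation C := R[i].

Lemma smooth_map_openT (A B : smooth_space R) F :
  smooth_map (smooth_open A setT) B F -> smooth_map A B F.
Proof.
move=> [AB oF sF]; split=> [x Ax|U /oF[]|U f oU /(sF _ _ oU)] /=.
- by apply: AB; split.
- by rewrite setIT.
by rewrite setIT.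
Qed.

Definition coords_index := ('I_3 * 'I_3 + 'I_3 * 'I_3)%type.
Definition coords_basis (i : coords_index) : Mcoords R :=
  match i with
  | inl i => (delta_mx i.1 i.2, 0)
  | inr i => (0, delta_mx i.1 i.2)
  end.
Definition coords_fun (i : coords_index) (p : Mcoords R) : R :=
  match i with inl i => p.1 i.1 i.2 | inr i => p.2 i.1 i.2 end.

Lemma coord_system_coords : coord_system coords_basis coords_fun.
Proof. exact: coord_system_pair (coord_system_matrix _ _) (coord_system_matrix _ _). Qed.

Lemma coord_system_coords3 :
  exists (I : finType) e (l : I -> Mcoords R * (Mcoords R * Mcoords R) -> R),
  coord_system e l /\ forall (V : normedModType R) (U : set V) (F : V -> Mat R * (Mat R * Mat R)),
    msmooth U (fun x => (F x).1) -> msmooth U (fun x => (F x).2.1) ->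
    msmooth U (fun x => (F x).2.2) -> forall i k, class_C k U
      (l i \o (fun x => (to_coords (F x).1, (to_coords (F x).2.1, to_coords (F x).2.2)))).
Proof.
have cs := coord_system_coords.
have c3 := coord_system_pair cs (coord_system_pair cs cs).
do 3 eexists; split; first exact: c3.
move=> V U F s1 s2 s3 [[i|i]|[[i|i]|[i|i]]] k.
- rewrite (_ : _ \o _ = fun x => complex.Re ((F x).1 i.1 i.2)); first exact: (s1 i.1 i.2).1.
  by apply/funext => x /=; rewrite mxE.
- rewrite (_ : _ \o _ = fun x => complex.Im ((F x).1 i.1 i.2)); first exact: (s1 i.1 i.2).2.
  by apply/funext => x /=; rewrite mxE.
- rewrite (_ : _ \o _ = fun x => complex.Re ((F x).2.1 i.1 i.2)); first exact: (s2 i.1 i.2).1.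
  by apply/funext => x /=; rewrite mxE.
- rewrite (_ : _ \o _ = fun x => complex.Im ((F x).2.1 i.1 i.2)); first exact: (s2 i.1 i.2).2.
  by apply/funext => x /=; rewrite mxE.
- rewrite (_ : _ \o _ = fun x => complex.Re ((F x).2.2 i.1 i.2)); first exact: (s3 i.1 i.2).1.
  by apply/funext => x /=; rewrite mxE.
rewrite (_ : _ \o _ = fun x => complex.Im ((F x).2.2 i.1 i.2)); first exact: (s3 i.1 i.2).2.
by apply/funext => x /=; rewrite mxE.
Qed.

Lemma smooth_map_Mat (V : normedModType R) (U : set V) (F : V -> Mat R) :
  open U -> msmooth U F -> smooth_map (smooth_open (linear_space V) U) (Mat_space R) F.
Proof.
move=> oU sF.
have -> : F = of_coords \o (to_coords \o F) by apply/funext => x /=; rewrite to_coordsK.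
apply: (@smooth_map_comp _ (smooth_open (linear_space V) U) (linear_space (Mcoords R))
  (Mat_space R) (to_coords \o F) of_coords);
  last exact: (@smooth_quot_proj _ (linear_space (Mcoords R))).
apply: (smooth_map_linear coord_system_coords) => // -[i|i] k.
  rewrite (_ : _ \o _ = fun x => complex.Re (F x i.1 i.2)); first exact: (sF i.1 i.2).1.
  by apply/funext => x /=; rewrite mxE.
rewrite (_ : _ \o _ = fun x => complex.Im (F x i.1 i.2)); first exact: (sF i.1 i.2).2.
by apply/funext => x /=; rewrite mxE.
Qed.

Lemma smooth_map_Mat3 (V : normedModType R) (U : set V) (F : V -> Mat R * (Mat R * Mat R)) :
  open U -> msmooth U (fun x => (F x).1) -> msmooth U (fun x => (F x).2.1) ->
  msmooth U (fun x => (F x).2.2) ->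
  smooth_map (smooth_open (linear_space V) U) (Mat3_space R) F.
Proof.
move=> oU s1 s2 s3; have [I [e [l [c H]]]] := coord_system_coords3.
pose F' x := (to_coords (F x).1, (to_coords (F x).2.1, to_coords (F x).2.2)).
have -> : F = of_coords3 \o F'.
  by apply/funext => x /=; rewrite /of_coords3 /of_coords2 /= !to_coordsK; case: (F x) => ? [].
apply: (@smooth_map_comp _ (smooth_open (linear_space V) U)
  (linear_space (Mcoords R * (Mcoords R * Mcoords R))%type) (Mat3_space R) F' of_coords3);
  last exact: (@smooth_quot_proj _ (linear_space _)).
by apply: (smooth_map_linear c) => // i k; exact: H.
Qed.

Lemma msmooth_linear_coords (V : normedModType R) (U : set V) (p : V -> Mcoords R) :
  linear p -> continuous p -> msmooth U (fun x => of_coords (p x)).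
Proof.
move=> linp cp i j; have [clin _] := coord_system_coords.
have sm k : smooth U (fun x => coords_fun k (p x)).
  have [link ck] := clin k => n; apply: class_C_linear.
    by move=> a u v; rewrite linp link.
  by move=> x; apply: continuous_comp; [exact: cp | exact: ck].
split.
  rewrite (_ : (fun x => _) = fun x => coords_fun (inl (i, j)) (p x)) //.
  by apply/funext => x; rewrite mxE.
rewrite (_ : (fun x => _) = fun x => coords_fun (inr (i, j)) (p x)) //.
by apply/funext => x; rewrite mxE.
Qed.

End Coordinates.

Section Forward.
Context {R : realType}.
Local Notation C := R[i].

(** The exponentials on the source, written without limits: only [Y_t] and
    [Z_(a,b)] matter, so [t] is read in an entry and the second exponential is
    a quadratic polynomial.  This extends the map smoothly to all triples of
    matrices. *)
Definition lift_Phi (p : Mat R * (Mat R * Mat R)) : Mat R :=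
  let t := complex.Re (p.2.1 0 ord_max) in
  p.1 *m hyp (cos t)%:C%C ('i * (sin t)%:C%C) *m
  (1%:M + 'i *: p.2.2 + 2^-1 *: (('i *: p.2.2) *m ('i *: p.2.2))).

Lemma lift_Phi_chart al be r t a b :
  lift_Phi (unipN al be *m elt_a r, (elt_Y t, elt_Z a b)) = chart al be r t a b.
Proof.
rewrite /lift_Phi /chart /= mxE /=; congr (_ *m _).
rewrite -expm_iZ expm_nilpotent; first by rewrite expr2.
have i2 : 'i * 'i = -1 :> C by rewrite -expr2 sqrCi.
rewrite exprZn; apply/eqP; rewrite scaler_eq0; apply/orP; right; apply/eqP.
rewrite !exprS expr0 mulr1 [X in _ * X]mulmx3 [LHS]mulmx3.
by mx3_entries; rewrite !mxE /=; ring.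
Qed.

Lemma Phi_chart al be r t a b :
  Phi (unipN al be *m elt_a r, (elt_Y t, elt_Z a b)) =
  act (chart al be r t a b) (base_point R).
Proof. by rewrite /Phi /= expm_Y expm_iZ. Qed.

Lemma NAP (g : Mat R) : grp_NA R g <-> exists al be r, g = unipN al be *m elt_a r.
Proof.
split.
  move=> [n [a [[Z [al [be ->]] <-] [r ->] ->]]].
  by exists al, be, r; rewrite expm_Z.
move=> [al [be [r ->]]]; exists (unipN al be), (elt_a r); split=> //.
  by exists (elt_Z al be); [exists al, be | exact: expm_Z].
by exists r.
Qed.

Lemma source_ind (P : Mat R * (Mat R * Mat R) -> Prop) :
  (forall al be r t a b, in_domain t a b ->
     P (unipN al be *m elt_a r, (elt_Y t, elt_Z a b))) ->
  forall p, (grp_NA R `*` domD R) p -> P p.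
Proof.
move=> H [g YZ] [/= /NAP[al [be [r ->]]] /domDP[t [a [b [-> D]]]]].
exact: H.
Qed.

Lemma smooth_lift_Phi : smooth_map (Mat3_space R) (Mat_space R) lift_Phi.
Proof.
apply: smooth_map_quot; apply: smooth_map_openT; apply: smooth_map_Mat.
  exact: openT.
have oT : open [set: Mcoords R * (Mcoords R * Mcoords R)] by exact: openT.
pose V := (Mcoords R * (Mcoords R * Mcoords R))%type.
have s1 : msmooth setT (fun p : V => of_coords p.1).
  by apply: msmooth_linear_coords => // x; exact: cvg_fst.
have s2 : msmooth setT (fun p : V => of_coords p.2.1).
  apply: msmooth_linear_coords => // x.
  by apply: (@continuous_comp _ _ _ snd fst); [exact: cvg_snd | exact: cvg_fst].
have s3 : msmooth setT (fun p : V => of_coords p.2.2).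
  apply: msmooth_linear_coords => // x.
  by apply: (@continuous_comp _ _ _ snd snd); [exact: cvg_snd | exact: cvg_snd].
apply: (msmoothM oT); first apply: (msmoothM oT) => //.
  have st : smooth setT (fun p : V => complex.Re (of_coords p.2.1 0 ord_max)).
    exact: (s2 0 ord_max).1.
  have sc : csmooth setT (fun p : V => (cos (complex.Re (of_coords p.2.1 0 ord_max)))%:C%C).
    apply: csmooth_real.
    by apply: (smooth_comp_real oT _ _ _ st); [exact: openT | move=> k; exact: (smooth_cos_sin k).1 |].
  have ss : csmooth setT (fun p : V => 'i * (sin (complex.Re (of_coords p.2.1 0 ord_max)))%:C%C).
    apply: (csmoothM oT); first exact: csmooth_cst.
    apply: csmooth_real.
    by apply: (smooth_comp_real oT _ _ _ st); [exact: openT | move=> k; exact: (smooth_cos_sin k).2 |].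
  apply: msmooth_mx3 => i j.
  elim/I3_ind: i; elim/I3_ind: j => /=; try exact: csmooth_cst; [exact: sc|exact: ss|exact: ss|exact: sc].
have si : msmooth setT (fun p : V => 'i *: of_coords p.2.2) by exact: msmoothZ.
apply: (msmoothD oT); first by apply: (msmoothD oT) => //; exact: msmooth_cst.
by apply: (msmoothZ oT); exact: msmoothM.
Qed.

Lemma det_lift_Phi p : (grp_NA R `*` domD R) p -> \det (lift_Phi p) = 1.
Proof.
by move: p; apply: source_ind => *; rewrite lift_Phi_chart det_chart.
Qed.

Lemma Phi_lift p : (grp_NA R `*` domD R) p ->
  act (lift_Phi p) (base_point R) = Phi p.
Proof.
by move: p; apply: source_ind => *; rewrite lift_Phi_chart Phi_chart.
Qed.

(** Elements of [NA] lie in SU(2,1), so both quantities may be computed at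
    [al = be = r = 0]. *)
Lemma herm_chart (al : C) (be r t : R) (a : C) (b : R) :
  (herm (vec (chart al be r t a b)) =
     (1 + 2 * b - complex.Re `|a| ^+ 2) * cos (2 * t) - complex.Re `|a| ^+ 2) *
  (hermr (cov (chart al be r t a b)) =
     (1 - 2 * b - complex.Re `|a| ^+ 2) * cos (2 * t) - complex.Re `|a| ^+ 2).
Proof.
have [m' [dm' chartE]] : exists m' : Mat R, \det m' = 1 /\
    forall al' be' r', chart al' be' r' t a b = (unipN al' be' *m elt_a r') *m m'.
  exists (hyp (cos t)%:C%C ('i * (sin t)%:C%C) *m
    unip ('i * a) ('i * a^*) (- b%:C%C + a * a^* / 2)).
  split=> [|al' be' r']; first by rewrite det_mulmx det_unip det_exp_iY mulr1.
  by rewrite /chart !mulmxA.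
have red al' be' r' : herm (vec (chart al' be' r' t a b)) = herm (vec m') /\
    hermr (cov (chart al' be' r' t a b)) = hermr (cov m').
  have G : SU21 R (unipN al' be' *m elt_a r').
    by apply: SU21M; [exact: SU21_unipN | exact: SU21_elt_a].
  rewrite chartE vecM; split; first exact: herm_SU21.
  by rewrite (cov_mulmx (proj2 G) dm'); exact: hermr_SU21.
have [e1 e2] := red al be r; have [f1 f2] := red 0 0 0.
rewrite e1 e2 -f1 -f2 norm2E.
have xE : stretch 0 t = phase t by rewrite /stretch expR0 mul1r.
have yE : stretch (- 0) (- t) = phase (- t) by rewrite /stretch oppr0 expR0 mul1r.
have yc : (phase (- t))^* = phase t :> C.
  by rewrite !phaseE cosN sinN; apply/eqP; rewrite eq_complex /= opprK !eqxx.
have p2 := phase_sqr t; have aa := normJE a.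
set A := complex.Re a ^+ 2 + complex.Im a ^+ 2 in aa *.
have ci : ('i : C)^* = - 'i by exact: conjCi.
have i2 : 'i * 'i = -1 :> C by rewrite -expr2 sqrCi.
have red2 (z : R) (u : C) : u * u^* = A%:C%C ->
   complex.Re (phase t * z%:C%C * phase t - ('i * u) * ('i * u)^*) = z * cos (2 * t) - A.
  move=> uu.
  have -> : phase t * z%:C%C * phase t - ('i * u) * ('i * u)^* = ((z * cos (2 * t) - A) +i* (z * sin (2 * t)))%C.
    rewrite rmorphM /= ci.
    transitivity (z%:C%C * (phase t * phase t) + ('i * 'i) * (u * u^*)); first by ring.
    by rewrite i2 uu p2 phaseE; apply/eqP; rewrite eq_complex /=; apply/andP; split; apply/eqP; ring.
  by [].
split.
  rewrite /herm; have [-> -> ->] := siegel_chart 0 0 0 t a b.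
  rewrite xE yE !rmorph0 !(mul0r, mulr0, addr0, subr0) yc aa.
  have -> : 1 + 2 * b%:C%C - A%:C%C = (1 + 2 * b - A)%:C%C :> C.
    by apply/eqP; rewrite eq_complex /=; apply/andP; split; apply/eqP; ring.
  by apply: red2; rewrite conjCK mulrC.
rewrite /hermr; have [-> -> ->] := siegel_chart_cov 0 0 0 t a b.
rewrite xE yE !rmorph0 !(mul0r, mulr0, addr0, subr0) yc aa.
have -> : 1 - 2 * b%:C%C - A%:C%C = (1 - 2 * b - A)%:C%C :> C.
  by apply/eqP; rewrite eq_complex /=; apply/andP; split; apply/eqP; ring.
exact: red2.
Qed.

Lemma crown_lift_chart (al : C) (be r t : R) (a : C) (b : R) : `|t| < pi / 4 ->
  crown_lift (chart al be r t a b) <-> in_domain t a b.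
Proof.
move=> t4; rewrite /crown_lift /in_domain !herm_chart.
set A := complex.Re _ ^+ 2; set c := cos _.
have bN : b <= `|b| := ler_norm b.
have bN' : - b <= `|b| by rewrite -normrN ler_norm.
have c0 : 0 < c by exact: cos_double_gt0.
have [bE|bE] : `|b| = b \/ `|b| = - b.
- by have [b0|b0] := leP 0 b; [left; rewrite ger0_norm | right; rewrite ltr0_norm].
- split=> [[_ h1 h2]|[_ H]].
    by split=> //; rewrite bE; lra.
  have h2 : 0 < (1 - 2 * b - A) * c - A by rewrite bE in H; lra.
  have h1 : 0 < (1 + 2 * b - A) * c - A.
    by have := mulr_ge0 (ltW c0) (normr_ge0 b); rewrite bE; lra.
  split=> //.
  apply: siegel_half_plane; rewrite ?herm_chart//.
  by rewrite cov_vec ?det_chart// mxE.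
split=> [[_ h1 h2]|[_ H]].
  by split=> //; rewrite bE; lra.
have h1 : 0 < (1 + 2 * b - A) * c - A by rewrite bE in H; lra.
have h2 : 0 < (1 - 2 * b - A) * c - A.
  by have := mulr_ge0 (ltW c0) (normr_ge0 b); rewrite bE; lra.
split=> //.
apply: siegel_half_plane; rewrite ?herm_chart//.
by rewrite cov_vec ?det_chart// mxE.
Qed.

Lemma smooth_map_Phi : smooth_map (NAxD R) (Cr R) Phi.
Proof.
apply: (@eq_smooth_map_sub _ (Mat3_space R) (Cr R) _
  (fun p => act (lift_Phi p) (base_point R))).
  by move=> p _; exact: Phi_lift.
have pres : presheaf (Mat3_space R) by apply: presheaf_quot; exact: presheaf_linear.
apply: (@smooth_map_corestrict _ (Mat3_space R) (XC R)) => //.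
  apply: (@smooth_map_comp _ (smooth_sub (Mat3_space R) (grp_NA R `*` domD R))
    (smooth_sub (Mat_space R) (SL3C R)) (XC R) lift_Phi
    (fun g => act g (base_point R))).
    apply: smooth_map_restrict; first exact: smooth_lift_Phi.
    by move=> p [_ Sp]; exact: det_lift_Phi.
  exact: smooth_quot_proj.
move=> p [_]; move: p; apply: source_ind => al be r t a b D.
rewrite lift_Phi_chart; apply/crown_liftP; first exact: det_chart.
by apply/crown_lift_chart => //; case: D.
Qed.

End Forward.

Section Backward.
Context {R : realType}.
Local Notation C := R[i].

Definition chart_inv (m : Mat R) : Mat R * (Mat R * Mat R) :=
  let v := vec m in let w := cov m in
  (unipN (dec_al v w) (dec_be v w) *m elt_a (dec_r v w),
   (elt_Y (dec_t v w), elt_Z (dec_a v w) (dec_b v w))).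

Lemma chart_inv_chart (al : C) (be r t : R) (a : C) (b : R) : in_domain t a b ->
  chart_inv (chart al be r t a b) = (unipN al be *m elt_a r, (elt_Y t, elt_Z a b)).
Proof.
move=> [t4 _]; rewrite /chart_inv dec_al_chart// dec_a_chart// dec_r_chart// dec_t_chart//.
by have [-> ->] := dec_bbe_chart al a be r b t4.
Qed.

(** The formulas are homogeneous of degree 0 under the scalings of [cosetP]. *)
Lemma chart_inv_coset (m m' : Mat R) : \det m = 1 -> \det m' = 1 ->
  act m (base_point R) = act m' (base_point R) -> chart_inv m' = chart_inv m.
Proof.
move=> d d' /(cosetP d d')[z z0 [ev ec]]; rewrite /chart_inv ev ec.
have kE : cq (z *: vec m) * rQ (z^-1 *: cov m) = cq (vec m) * rQ (cov m).
  by rewrite siegelZ siegelZr mulrACA mulfV// mul1r.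
have e1 : pt1 (z *: vec m) = pt1 (vec m) by rewrite /pt1 !siegelZ -mulf_div divff// mul1r.
have z0' : z^-1 != 0 by rewrite invr_eq0.
have e2 : pt2 (z^-1 *: cov m) = pt2 (cov m).
  by rewrite /pt2 !siegelZr -mulf_div divff// mul1r.
have hE : height (z *: vec m) (z^-1 *: cov m) = height (vec m) (cov m).
  by rewrite /height !siegelZ !siegelZr -mulf_div divff// -[X in _ - X]mulf_div divff// !mul1r.
by rewrite /dec_be /dec_b /dec_a /dec_al /eta /slope /mean_s /diff_s /dec_t /dec_r kE e1 e2 hE.
Qed.

Lemma chart_inv_in_source (m : Mat R) : \det m = 1 -> crown_lift m ->
  (grp_NA R `*` domD R) (chart_inv m) /\ Phi (chart_inv m) = act m (base_point R).
Proof.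
move=> dm cm; have [k0 _ _] := cm.
have wv : (cov m *m vec m) 0 0 = 1 by rewrite cov_vec// mxE.
have [z z0 [ev ec]] := chart_decode wv k0.
set n := chart _ _ _ _ _ _ in ev ec.
have dn : \det n = 1 by exact: det_chart.
have nm : act m (base_point R) = act n (base_point R).
  by apply/cosetP => //; exists z.
split; last by rewrite /chart_inv Phi_chart.
split; first by apply/NAP; do 3 eexists.
apply/domDP; do 3 eexists; split; first by [].
have : crown_lift n by exact: crown_lift_invariant nm cm.
by move/crown_lift_chart => H; apply: H; exact: dec_t_bound.
Qed.

(** The value at a coset is computed on an arbitrary representative of determinant 1,
    which is harmless by [chart_inv_coset]. *)
Definition inverse_Phi (x : set (Mat R)) : Mat R * (Mat R * Mat R) :=
  chart_inv (xget 1%:M [set m | \det m = 1 /\ act m (base_point R) = x]).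

Lemma inverse_PhiE (m : Mat R) : \det m = 1 ->
  inverse_Phi (act m (base_point R)) = chart_inv m.
Proof.
move=> dm; rewrite /inverse_Phi; case: xgetP => [m' _ [dm' E]|/(_ m)[]//].
by apply: chart_inv_coset => //; rewrite E.
Qed.

End Backward.

(** * Smoothness of the inverse *)

Section SmoothDecode.
Context {R : realType} {V : normedModType R}.
Local Notation C := R[i].
Variables (U : set V).
Hypothesis oU : open U.
Variables (v : V -> 'cV[C]_3) (w : V -> 'rV[C]_3).
Hypotheses (sv : msmooth U v) (sw : msmooth U w).

Lemma csmooth_cp : csmooth U (fun x => cp (v x)).
Proof. by apply: (csmoothD oU); exact: sv. Qed.
Lemma csmooth_cs : csmooth U (fun x => cs (v x)).
Proof. exact: sv. Qed.
Lemma csmooth_cq : csmooth U (fun x => cq (v x)).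
Proof. by apply: (csmoothB oU); exact: sv. Qed.
Lemma csmooth_rP : csmooth U (fun x => rP (w x)).
Proof. by apply: (csmoothB oU); exact: sw. Qed.
Lemma csmooth_rS : csmooth U (fun x => rS (w x)).
Proof. by apply: (csmoothN oU); exact: sw. Qed.
Lemma csmooth_rQ : csmooth U (fun x => rQ (w x)).
Proof. by apply: (csmoothD oU); exact: sw. Qed.
Lemma csmooth_kap : csmooth U (fun x => cq (v x) * rQ (w x)).
Proof. exact: (csmoothM oU csmooth_cq csmooth_rQ). Qed.

Lemma smooth_herm : smooth U (fun x => herm (v x)).
Proof.
suff [] : csmooth U (fun x => cp (v x) * (cq (v x))^* - cs (v x) * (cs (v x))^*) by [].
apply: (csmoothB oU); apply: (csmoothM oU); try (apply: csmooth_conj => //);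
  solve [exact: csmooth_cp | exact: csmooth_cs | exact: csmooth_cq].
Qed.

Lemma smooth_hermr : smooth U (fun x => hermr (w x)).
Proof.
suff [] : csmooth U (fun x => rP (w x) * (rQ (w x))^* - rS (w x) * (rS (w x))^*) by [].
apply: (csmoothB oU); apply: (csmoothM oU); try (apply: csmooth_conj => //);
  solve [exact: csmooth_rP | exact: csmooth_rS | exact: csmooth_rQ].
Qed.

Hypothesis kap0 : forall x, U x -> 0 < complex.Re (cq (v x) * rQ (w x)).

Lemma smooth_scale (c : R) (f : V -> R) : smooth U f -> smooth U (fun x => f x / c).
Proof. by move=> sf; apply: (smoothM oU) => //; exact: smooth_cst. Qed.

Let kap_neq0 x : U x -> cq (v x) != 0 /\ rQ (w x) != 0.
Proof. by move=> /kap0/Re_gt0_neq0; rewrite mulf_eq0 negb_or => /andP[]. Qed.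

Let smooth_comp_setT (p f : _ -> R) : smooth setT p -> smooth U f ->
  smooth U (fun x => p (f x)).
Proof. by move=> sp sf; apply: (smooth_comp_real oU _ sp) => //; exact: openT. Qed.

Lemma smooth_dec_r : smooth U (fun x => dec_r (v x) (w x)).
Proof.
have [kr ki] := csmooth_kap.
apply: (smoothN oU); apply: smooth_scale.
apply: (smooth_comp_real oU (@open_gt _ 0) smooth_ln) => [x Ux|].
  by apply: norm2_gt0; exact: Re_gt0_neq0 (kap0 Ux).
by apply: (smoothD oU); apply: (smoothM oU).
Qed.

Lemma smooth_dec_t : smooth U (fun x => dec_t (v x) (w x)).
Proof.
have [kr ki] := csmooth_kap.
apply: (smoothN oU); apply: smooth_scale; apply: (smooth_comp_setT smooth_atan).
apply: (smoothM oU) => //; apply: (smoothV oU) => // x Ux.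
by rewrite gt_eqF// kap0.
Qed.

Lemma smooth_cos_dec_t : smooth U (fun x => cos (dec_t (v x) (w x))).
Proof. by apply: smooth_comp_setT smooth_dec_t => k; exact: (smooth_cos_sin k).1. Qed.

Lemma smooth_sin_dec_t : smooth U (fun x => sin (dec_t (v x) (w x))).
Proof. by apply: smooth_comp_setT smooth_dec_t => k; exact: (smooth_cos_sin k).2. Qed.

Let smooth_inv_cos : smooth U (fun x => (cos (dec_t (v x) (w x)))^-1).
Proof.
apply: (smoothV oU) smooth_cos_dec_t => x Ux.
by rewrite gt_eqF// cos_gt0_piquarter//; exact: dec_t_bound (kap0 Ux).
Qed.

Lemma smooth_slope : smooth U (fun x => slope (v x) (w x)).
Proof. exact: (smoothM oU smooth_sin_dec_t smooth_inv_cos). Qed.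

Lemma csmooth_pt1 : csmooth U (fun x => pt1 (v x)).
Proof.
apply: (csmoothM oU csmooth_cs); apply: (csmoothV oU _ csmooth_cq).
by move=> x /kap_neq0[].
Qed.

Lemma csmooth_pt2 : csmooth U (fun x => pt2 (w x)).
Proof.
apply: (csmoothM oU csmooth_rS); apply: (csmoothV oU _ csmooth_rQ).
by move=> x /kap_neq0[].
Qed.

Lemma csmooth_mean_s : csmooth U (fun x => mean_s (v x) (w x)).
Proof.
apply: (csmoothM oU); last exact: csmooth_cst.
exact: (csmoothD oU csmooth_pt1 (csmooth_conj oU csmooth_pt2)).
Qed.

Lemma csmooth_diff_s : csmooth U (fun x => diff_s (v x) (w x)).
Proof.
apply: (csmoothM oU); last exact: csmooth_cst.
exact: (csmoothB oU csmooth_pt1 (csmooth_conj oU csmooth_pt2)).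
Qed.

Lemma csmooth_height : csmooth U (fun x => height (v x) (w x)).
Proof.
apply: (csmoothB oU).
  apply: (csmoothM oU csmooth_cp); apply: (csmoothV oU _ csmooth_cq).
  by move=> x /kap_neq0[].
apply: (csmoothM oU csmooth_rP); apply: (csmoothV oU _ csmooth_rQ).
by move=> x /kap_neq0[].
Qed.

Lemma smooth_eta : smooth U (fun x => eta (v x) (w x)).
Proof. exact: (csmoothM oU (csmooth_conj oU csmooth_mean_s) csmooth_diff_s).2. Qed.

Lemma csmooth_dec_al : csmooth U (fun x => dec_al (v x) (w x)).
Proof.
apply: (csmoothD oU); first exact: (csmooth_conj oU csmooth_mean_s).
apply: (csmoothM oU); first exact: (csmooth_conj oU csmooth_diff_s).
exact: (csmooth_real smooth_slope).
Qed.

Lemma smooth_expN_dec_r : smooth U (fun x => expR (- dec_r (v x) (w x))).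
Proof. exact: (smooth_comp_setT smooth_expR (smoothN oU smooth_dec_r)). Qed.

Lemma csmooth_dec_a : csmooth U (fun x => dec_a (v x) (w x)).
Proof.
apply: (csmoothM oU); first exact: (csmooth_conj oU csmooth_diff_s).
exact: (csmooth_real (smoothM oU smooth_expN_dec_r smooth_inv_cos)).
Qed.

Let csmooth_kapV : csmooth U (fun x => (cq (v x) * rQ (w x))^-1).
Proof. by apply: (csmoothV oU _ csmooth_kap) => x Ux; exact: Re_gt0_neq0 (kap0 Ux). Qed.

Lemma Re_inv_gt0 (k : C) : 0 < complex.Re k -> 0 < complex.Re k^-1.
Proof.
case: k => x y /= x0; rewrite divr_gt0// ltr_pwDl ?sqr_ge0// exprn_gt0//.
Qed.

Lemma smooth_dec_b : smooth U (fun x => dec_b (v x) (w x)).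
Proof.
apply: (smoothM oU).
  by apply: (smoothD oU); [apply: smooth_scale; exact: csmooth_height.1 | exact: smooth_eta].
apply: (smoothV oU _ csmooth_kapV.1) => x Ux.
by rewrite gt_eqF// Re_inv_gt0// kap0.
Qed.

Lemma smooth_dec_be : smooth U (fun x => dec_be (v x) (w x)).
Proof.
apply: (smoothB oU); last by apply: smooth_scale; exact: csmooth_height.2.
apply: (smoothB oU); apply: (smoothM oU).
- exact: smooth_dec_b.
- exact: csmooth_kapV.2.
- exact: smooth_slope.
exact: smooth_eta.
Qed.

End SmoothDecode.

Section SmoothGroupElements.
Context {R : realType} {V : normedModType R}.
Local Notation C := R[i].
Variables (U : set V).
Hypothesis oU : open U.

Lemma msmooth_unipN (al : V -> C) (be : V -> R) :
  csmooth U al -> smooth U be -> msmooth U (fun x => unipN (al x) (be x)).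
Proof.
move=> sa sb.
have sc := csmooth_conj oU sa.
have sh : csmooth U (fun x => 'i * (be x)%:C%C - al x * (al x)^* / 2).
  apply: (csmoothB oU); apply: (csmoothM oU); try exact: csmooth_cst.
    exact: csmooth_real.
  exact: csmoothM.
have s0 (c : C) : csmooth U (fun=> c) by exact: csmooth_cst.
apply: msmooth_mx3 => i j; elim/I3_ind: i; elim/I3_ind: j => /=;
  solve [exact: s0 | exact: sh | exact: sa | exact: sc | exact: csmoothN
       | exact: csmoothD | exact: csmoothB].
Qed.

Lemma msmooth_elt_a (r : V -> R) : smooth U r -> msmooth U (fun x => elt_a (r x)).
Proof.
move=> sr.
have oT : open [set: R] by exact: openT.
have s1 : smooth U (fun x => expR (r x)) by apply: (smooth_comp_real oU oT smooth_expR).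
have s2 : smooth U (fun x => expR (- r x)).
  by apply: (smooth_comp_real oU oT smooth_expR) => //; exact: smoothN.
have sc : csmooth U (fun x => ((expR (r x) + expR (- r x)) / 2)%:C%C).
  by apply: csmooth_real; apply: (smooth_scale oU); exact: smoothD.
have ss : csmooth U (fun x => ((expR (r x) - expR (- r x)) / 2)%:C%C).
  by apply: csmooth_real; apply: (smooth_scale oU); exact: smoothB.
apply: msmooth_mx3 => i j; elim/I3_ind: i; elim/I3_ind: j => /=;
  solve [exact: csmooth_cst | exact: sc | exact: ss].
Qed.

Lemma msmooth_elt_Y (t : V -> R) : smooth U t -> msmooth U (fun x => elt_Y (t x)).
Proof.
move=> st; apply: msmooth_mx3 => i j; elim/I3_ind: i; elim/I3_ind: j => /=;
  solve [exact: csmooth_cst | exact: csmooth_real].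
Qed.

Lemma msmooth_elt_Z (a : V -> C) (b : V -> R) :
  csmooth U a -> smooth U b -> msmooth U (fun x => elt_Z (a x) (b x)).
Proof.
move=> sa sb; have sc := csmooth_conj oU sa.
have sib : csmooth U (fun x => 'i * (b x)%:C%C).
  by apply: (csmoothM oU); [exact: csmooth_cst | exact: csmooth_real].
apply: msmooth_mx3 => i j; elim/I3_ind: i; elim/I3_ind: j => /=;
  solve [exact: csmooth_cst | exact: sib | exact: sa | exact: sc | exact: csmoothN].
Qed.

End SmoothGroupElements.

Section Main.
Context {R : realType}.
Local Notation C := R[i].

Let smooth_mat (U : set (Mcoords R)) : msmooth U (@of_coords R).
Proof. by apply: (@msmooth_linear_coords _ _ _ id) => // x; exact: cvg_id. Qed.

Let smooth_vec (U : set (Mcoords R)) : msmooth U (fun x => vec (of_coords x)).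
Proof.
move=> i j; rewrite (_ : (fun x => _) = fun x => of_coords x i ord_max).
  exact: smooth_mat.
by apply/funext => x; rewrite mxE.
Qed.

Let smooth_cov (U : set (Mcoords R)) : open U ->
  msmooth U (fun x => cov (of_coords x)).
Proof.
move=> oU i j; rewrite (_ : (fun x => _) = fun x => (\adj (of_coords x)) ord_max j).
  exact: msmooth_adj.
by apply/funext => x; rewrite mxE.
Qed.

Lemma open_crown_lift : open (of_coords @^-1` (@crown_lift R)).
Proof.
have oT : open [set: Mcoords R] by exact: openT.
have op (f : Mcoords R -> R) : smooth setT f -> open [set x | 0 < f x].
  move=> sf; apply: (@open_comp _ _ f [set y | 0 < y]); last exact: open_gt.
  by move=> x _; exact: class_C_cont (sf 0%N) I.
rewrite (_ : _ @^-1` _ = [set x | 0 < complex.Re (cq (vec (of_coords x)) * rQ (cov (of_coords x)))]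
   `&` [set x | 0 < herm (vec (of_coords x))] `&` [set x | 0 < hermr (cov (of_coords x))]).
  apply: openI; first apply: openI; apply: op.
  - exact: (csmooth_kap oT (smooth_vec _) (smooth_cov oT)).1.
  - exact: (smooth_herm oT (smooth_vec _)).
  - exact: (smooth_hermr oT (smooth_cov oT)).
by apply/seteqP; split=> [x []|x [[]]].
Qed.

Lemma smooth_chart_inv :
  smooth_map (smooth_open (Mat_space R) (@crown_lift R)) (Mat3_space R) chart_inv.
Proof.
apply: smooth_map_quot_open.
have oU := open_crown_lift.
have sv := @smooth_vec (of_coords @^-1` (@crown_lift R)).
have sw := smooth_cov oU.
have k0 x : (of_coords @^-1` (@crown_lift R)) x ->
    0 < complex.Re (cq (vec (of_coords x)) * rQ (cov (of_coords x))) by case.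
apply: smooth_map_Mat3 => //=.
- apply: (msmoothM oU).
    apply: (msmooth_unipN oU); first exact: (csmooth_dec_al oU sv sw k0).
    exact: (smooth_dec_be oU sv sw k0).
  exact: (msmooth_elt_a oU (smooth_dec_r oU sv sw k0)).
- exact: (msmooth_elt_Y (smooth_dec_t oU sv sw k0)).
apply: (msmooth_elt_Z oU); first exact: (csmooth_dec_a oU sv sw k0).
exact: (smooth_dec_b oU sv sw k0).
Qed.

(** The inverse is smooth on matrices; it is first restricted to SL(3,C), where it
    is constant on cosets, and then descends to the quotient. *)
Lemma smooth_inverse_Phi : smooth_map (Cr R) (NAxD R) (@inverse_Phi R).
Proof.
have presM : presheaf (Mat_space R) by apply: presheaf_quot; exact: presheaf_linear.
have presX : presheaf (XC R) by apply: presheaf_quot; exact: presheaf_sub.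
apply: (@smooth_map_corestrict _ (XC R) (Mat3_space R)) => //.
  apply: smooth_map_sub_of_open; apply: smooth_map_quot_open.
  apply: (smooth_map_open_sub smooth_chart_inv) => [m _ dm|m _ dm _].
    exact: crown_liftP.
  exact: inverse_PhiE.
move=> _ [[m [_ dm] <-] /(crown_liftP dm) cm].
by rewrite inverse_PhiE//; have [] := chart_inv_in_source dm cm.
Qed.

End Main.

Theorem proposition2p2 (R : realType) :
  diffeomorphism (NAxD R) (Cr R) Phi.
Proof.
split; first exact: smooth_map_Phi.
exists (@inverse_Phi R); split; first exact: smooth_inverse_Phi.
- move=> p [_]; move: p; apply: source_ind => al be r t a b D.
  by rewrite Phi_chart inverse_PhiE ?det_chart// chart_inv_chart.
move=> _ [[m [_ dm] <-] /(crown_liftP dm) cm].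
by rewrite inverse_PhiE//; have [] := chart_inv_in_source dm cm.
Qed.
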